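(* Let $n\ge 3$ be odd and let $V$ be a fixed point free $D_n$-representation not containing $\sigma$ as a summand, such that for each prime power $p^k$ ($k\ge 1$) dividing $n$, $V^{C_{p^k}}\neq(0)$, where $C_{p^k}\subset\langle x\rangle\subset D_n$ is the cyclic subgroup of order $p^k$. Then $V$ has the anti-Borsuk-Ulam property.
   Context: $D_n=\langle x,y\mid x^n=y^2=1,\ yx=x^{-1}y\rangle$ is the dihedral group of order $2n$, and $\sigma$ is the one-dimensional real sign representation of $D_n$ on which $x$ acts trivially and $y$ acts by $-1$. Representations are finite-dimensional real orthogonal representations; $V$ is fixed point free if $V^{D_n}=\{0\}$. $S(V)=\{v\in V:\|v\|=1\}$ with the induced action. A real representation $V$ of a finite group $G$ has the anti-Borsuk-Ulam property if for every $r$ there is a representation $U$ of $G$ with $\dim(U)>r$ and a continuous $G$-equivariant map $S(U)\to S(V)$. *)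

(* Defs.v *)
From HB Require Import structures.
From mathcomp Require Import all_boot all_order all_fingroup all_algebra.
From mathcomp Require Import all_solvable.
From mathcomp Require Import mxrepresentation character.
From mathcomp Require Import boolp classical_sets functions reals topology.
From mathcomp Require Import normedtype.

Set Implicit Arguments.
Unset Strict Implicit.
Unset Printing Implicit Defensive.

Import GroupScope Order.TTheory GRing.Theory Num.Theory.
Import numFieldNormedType.Exports.
Local Open Scope ring_scope.
Local Open Scope classical_set_scope.

(* G = < x, y | x^n = y^2 = 1, yx = x^-1 y >: the first conjunct says that G
   has this presentation for some generators, the others that x and y are
   such generators. *)
Definition dihedral_presentation (gT : finGroupType) (n : nat)
    (G : {group gT}) (x y : gT) : Prop :=
  [/\ (G \isog Grp (a : b : a ^+ n, b ^+ 2, b * a = a^-1 * b))%g,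
      <<[set x; y]%SET>>%g = G,
      (x ^+ n = 1)%g, (y ^+ 2 = 1)%g & (y * x = x^-1 * y)%g].

(* A finite-dimensional real orthogonal representation of G is R^d with its
   standard inner product and a matrix representation by orthogonal matrices.
   Following mxrepresentation, vectors are rows and v *m rG g is the (right)
   action of g; as a left action it is that of g^-1. *)
Definition orthogonal_repr (R : realType) (gT : finGroupType) (G : {group gT})
    (d : nat) (rG : mx_representation R G d) : Prop :=
  forall g, g \in G -> rG g *m (rG g)^T = 1%:M.

(* The library norm `|v| on row vectors is the sup norm. *)
Definition enorm (R : realType) (d : nat) (v : 'rV[R]_d) : R :=
  Num.sqrt (\sum_(i < d) v ord0 i ^+ 2).

Definition unit_sphere (R : realType) (d : nat) : set 'rV[R]_d :=
  [set v | enorm v = 1].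
Arguments unit_sphere R d : clear implicits.

Definition equivariant_sphere_map (R : realType) (gT : finGroupType)
    (G : {group gT}) (m d : nat) (rU : mx_representation R G m)
    (rV : mx_representation R G d) (f : 'rV[R]_m -> 'rV[R]_d) : Prop :=
  [/\ {within unit_sphere R m, continuous f},
      forall u, unit_sphere R m u -> unit_sphere R d (f u)
    & forall g u, g \in G -> unit_sphere R m u ->
        f (u *m rU g) = f u *m rV g].

Definition anti_Borsuk_Ulam (R : realType) (gT : finGroupType)
    (G : {group gT}) (d : nat) (rV : mx_representation R G d) : Prop :=
  forall r : nat, exists (m : nat) (rU : mx_representation R G m),
    [/\ orthogonal_repr rU, (r < m)%N
      & exists f : 'rV[R]_m -> 'rV[R]_d, equivariant_sphere_map rU rV f].

Definition fixed_point_free (R : realType) (gT : finGroupType)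
    (G : {group gT}) (d : nat) (rV : mx_representation R G d) : Prop :=
  rfix_mx rV G = 0.

Definition has_summand (R : realType) (gT : finGroupType) (G : {group gT})
    (d e : nat) (rV : mx_representation R G d)
    (rS : mx_representation R G e) : Prop :=
  exists rW : representation R G,
    mx_rsim rV (dadd_grepr (Representation rS) rW).

(* Main.v *)
Require Import Defs.
From mathcomp Require Import all_boot all_order all_fingroup all_algebra.
From mathcomp Require Import all_solvable mxrepresentation character.
From mathcomp Require Import boolp classical_sets reals topology normedtype.
From mathcomp Require Import realfun complex separable cyclotomic.
From mathcomp Require Import ring lra zify.

Set Implicit Arguments.
Unset Strict Implicit.
Unset Printing Implicit Defensive.

Import Order.TTheory GRing.Theory Num.Theory.
Import numFieldNormedType.Exports.
Local Open Scope ring_scope.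
Local Open Scope complex_scope.

(**
Write V_k for the plane C on which x acts as multiplication by om^k, om a
primitive n-th root of unity, and y as complex conjugation. Since V has no
trivial summand and no summand sigma, it is a sum of planes V_j with j nonzero
mod n; as n is odd and V_j is isomorphic to V_(n-j), all j may be taken odd.
If p^a is the exact power of the prime p dividing n, a nonzero vector fixed by
the subgroup of order p^a has a nonzero component in some V_j with p^a | j
([exists_weight]). So V contains pairwise non-isomorphic planes V_j, j in J,
all j odd, with lcm(J) divisible by n. It suffices to map the unit sphere of E
= N V_1, for every N, equivariantly to the nonzero vectors of the sum of the
V_j: the target is then pushed into V and normalised.

This is done by a recursion on J, which splits one plane into two
([split_weight]): from an equivariant function l on E with values in
V_(lcm(k1,k2)), equivariant functions a, b with values in V_k1, V_k2 are
built, such that (a, b) is nonzero wherever l and the point of E are nonzero.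
The recursion starts from l = 1, which is equivariant for the weight lcm(J),
because n divides lcm(J) and the conjugation fixes 1 ([split_weights]).

To split, suppose first that n divides lcm(k1,k2) and l = 1. The heart of the
matter is an equivariant map f from V_k1 + V_k2 to itself, without zeros away
from the origin, that is homotopic to a constant through maps without zeros
that need only commute with the reflection y. Normalised, such an f has degree
zero as a self-map of a sphere of dimension 3; it exists because k/k1 and
k/k2, where k = lcm(k1,k2), are coprime. Both f and the homotopy are given by
explicit monomials ([nullhtpy1], [nullhtpy2]). The homotopy extends f to the
cone on the sphere of V_k1 + V_k2, and spreading this cone over the n
translates of the vertex extends f equivariantly to the join of the sphere
with an orbit of type G / <y> ([spread]). Every vector of V_1 other than 0 is
close to the orbit of 1 or to the orbit of -1, so the construction, done
twice, gives a map from V_k1 + V_k2 + V_1 to V_k1 + V_k2 whose only zero is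
the origin; iterating it N times, and restricting to E, gives (a, b). A
general l is first moved to a positive real number along a segment, which is
possible outside the negative reals; the same construction with -l in place of
l takes care of the negative reals ([spread4]).
*)

Local Notation Re := complex.Re.
Local Notation Im := complex.Im.

(** * Squared moduli and positive parts *)

Definition pospart (R : realType) (a : R) : R := Num.max 0 a.
Definition sqmod (R : realType) (z : R[i]) : R := Re z ^+ 2 + Im z ^+ 2.

Lemma pospart_gt0 (R : realType) (a : R) : 0 < a -> pospart a = a.
Proof. by move=> a0; rewrite /pospart; apply/max_idPr/ltW. Qed.
Lemma pospart_le0 (R : realType) (a : R) : a <= 0 -> pospart a = 0.
Proof. by move=> a0; rewrite /pospart; apply/max_idPl. Qed.
Lemma pospart_ge0 (R : realType) (a : R) : 0 <= pospart a.
Proof. by rewrite /pospart le_max lexx. Qed.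
Lemma pospart_eq0 (R : realType) (a : R) : (pospart a == 0) = (a <= 0).
Proof.
have [h|h] := leP a 0; first by rewrite pospart_le0 ?eqxx.
by rewrite pospart_gt0 // gt_eqF.
Qed.
Lemma sqmod_ge0 (R : realType) (z : R[i]) : 0 <= sqmod z.
Proof. by rewrite addr_ge0 ?sqr_ge0. Qed.
Lemma sqmod_eq0 (R : realType) (z : R[i]) : (sqmod z == 0) = (z == 0).
Proof.
by case: z => a b; rewrite eq_complex /sqmod /= paddr_eq0 ?sqr_ge0 // !sqrf_eq0.
Qed.
Lemma sqmodE (R : realType) (z : R[i]) : (sqmod z)%:C = z * conjc z.
Proof. by case: z => a b; simpc; rewrite /sqmod /=; congr (_ +i* _); ring. Qed.
Lemma sqmodM (R : realType) (z w : R[i]) : sqmod (z * w) = sqmod z * sqmod w.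
Proof. by apply: complexI; rewrite rmorphM /= !sqmodE rmorphM /=; ring. Qed.
Lemma sqmodJ (R : realType) (z : R[i]) : sqmod (conjc z) = sqmod z.
Proof. by case: z => a b; rewrite /sqmod /= sqrrN. Qed.
Lemma real_complex_eq0 (R : realType) (a : R) : (a%:C == 0) = (a == 0).
Proof. by rewrite eq_complex /= eqxx andbT. Qed.

(** This is where the parities of the two exponents enter: z^(y d) would be
both positive and negative. *)
Lemma no_common_negative_power (R : realType) (z : R[i]) (a b : R) (y d : nat) :
  ~~ odd y -> odd d -> 0 < a -> 0 < b ->
  z ^+ y = - a%:C -> z ^+ d = - b%:C -> False.
Proof.
move=> ye od a0 b0 zy zd.
have : (z ^+ y) ^+ d = (z ^+ d) ^+ y by rewrite -!exprM mulnC.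
rewrite zy zd -!rmorphN /= -!rmorphXn /= => /complexI.
rewrite exprNn -signr_odd od expr1 exprNn -signr_odd (negbTE ye) expr0.
rewrite mul1r mulN1r => h.
have h1 : 0 < b ^+ y by rewrite exprn_gt0.
have h2 : 0 < a ^+ d by rewrite exprn_gt0.
by move: h1; rewrite -h oppr_gt0 ltNge ltW.
Qed.

(** * A null-homotopic equivariant map and its null-homotopy *)

Section Core.
Variables (R : realType) (y y1 y2 d d1 d2 : nat).
Implicit Types (z w l : R[i]) (t : R).

(** The components of a null-homotopy on the cone over the sphere of
V_k1 + V_k2, with coordinates z, w and cone coordinate t >= 0, the cone point
being z = w = 0; l in V_k is a parameter, and the powers of l and of its
conjugate only adjust the weights.
The point with barycentric coordinates |w|^2, |z|^2, t of a triangle is sent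
to a combination of vectors that are attached to points of its boundary.  From
the vertex w to the vertex z there are
  (0, w^d),  ((z w~)^y, 0),  (0, (z w)^d),  (z^y, 0),
and from the vertex w to the vertex t
  (0, w^d),  (w~^y, w^d),  (w~^y, 1),  (1, 1),
where ~ is conjugation.  As W / N decreases, one moves alternately along the
two sides, so that at any time at most three of these vectors have nonzero
coefficients; for y even, d odd and nonzero z, w, a combination of these three
with nonnegative coefficients vanishes only if the coefficients do.  So the
triangle is triangulated without interior vertices.  On the side t = 0 all
vectors are equivariant for suitable y and d ([nullhtpy1_rot],
[nullhtpy2_rot]); the vector (1, 1) at the vertex t is constant. *)
Definition nullhtpy1 z w l t : R[i] :=
  let W := sqmod w in let N := sqmod z + t in
  (pospart (W - 3 * N))%:C * (z * conjc w) ^+ y * (conjc l ^+ y2 * l ^+ y1)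
  + (pospart (2 * N - W))%:C * z ^+ y * conjc l ^+ y2
  + t%:C * ((pospart (W - 2 * N) + pospart (3 * N - W))%:C * conjc w ^+ y
            + (pospart (N - W))%:C).

Definition nullhtpy2 z w l t : R[i] :=
  let W := sqmod w in let N := sqmod z + t in
  (pospart (W - 4 * N))%:C * w ^+ d * conjc l ^+ d2
  + (pospart (4 * N - W) * pospart (W - N))%:C * (z * w) ^+ d
    * conjc l ^+ (d2 + d1)
  + t%:C * ((pospart (W - 2 * N))%:C * w ^+ d
            + (pospart (3 * N - W) + pospart (N - W))%:C).

Hypotheses (y_gt0 : (0 < y)%N) (y_even : ~~ odd y) (d_odd : odd d).

(** At t = 0 each component is one monomial with a nonnegative coefficient, and
the two coefficients are never both 0; only the axes z = 0 and w = 0, where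
monomials vanish, need separate treatment. *)
Lemma nullhtpy_eq0_start z w l : l != 0 ->
  nullhtpy1 z w l 0 = 0 -> nullhtpy2 z w l 0 = 0 -> z = 0 /\ w = 0.
Proof.
move=> l0; rewrite /nullhtpy1 /nullhtpy2 !mul0r !addr0.
have d0 : (0 < d)%N by case: d d_odd.
have lc : conjc l != 0 by rewrite conjc_eq0.
have := sqmod_eq0 w; have := sqmod_eq0 z.
have := sqmod_ge0 w; have := sqmod_ge0 z.
move: (sqmod w) (sqmod z) => W N N_ge0 W_ge0 z_eq w_eq.
have [z0|z0] := eqVneq z 0.
  move: z_eq; rewrite z0 eqxx => /eqP ->; rewrite !mulr0 !subr0 !sub0r.
  rewrite !mul0r !expr0n !eqn0Ngt d0 y_gt0 /= !(mulr0, mul0r, addr0) => _ /eqP.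
  rewrite !mulf_eq0 !expf_eq0 d0 (negbTE lc) andbF orbF real_complex_eq0.
  by rewrite pospart_eq0 /= => /orP[W0|/eqP ->] //; split=> //; apply/eqP; rewrite -w_eq eq_le W0.
have N0 : 0 < N by rewrite lt_def z_eq z0.
have [w0|w0] := eqVneq w 0.
  move: w_eq; rewrite w0 eqxx => /eqP ->; rewrite conjc0 mulr0 !subr0 !sub0r.
  rewrite !expr0n !eqn0Ngt y_gt0 /= !(mulr0, mul0r, add0r) => /eqP.
  rewrite !mulf_eq0 !expf_eq0 (negbTE lc) (negbTE z0) !andbF !orbF real_complex_eq0.
  by rewrite pospart_eq0 => h; exfalso; lra.
have W0 : 0 < W by rewrite lt_def w_eq w0.
have wc : conjc w != 0 by rewrite conjc_eq0.
have nz2 (a : R) (x1 x2 : R[i]) : 0 < a -> x1 != 0 -> x2 != 0 ->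
    (pospart a)%:C * x1 * x2 = 0 -> False.
  move=> a0 h1 h2 /eqP; rewrite !mulf_eq0 (negbTE h1) (negbTE h2) !orbF.
  by rewrite real_complex_eq0 pospart_eq0 leNgt a0.
have [hA|hA] := ltP W (2 * N).
  rewrite (@pospart_le0 _ (W - 3 * N)) ?mul0r ?add0r; last lra.
  by move=> h; exfalso; apply: nz2 h; rewrite ?expf_neq0 //; lra.
have [hB|hB] := ltP (3 * N) W.
  rewrite (@pospart_le0 _ (2 * N - W)) ?mul0r ?addr0; last lra.
  by move=> h; exfalso; apply: nz2 h; rewrite ?mulf_neq0 ?expf_neq0 ?mulf_neq0 //; lra.
rewrite (@pospart_le0 _ (W - 4 * N)) ?mul0r ?add0r; last lra.
move=> _ /eqP; rewrite !mulf_eq0 !expf_eq0 (negbTE lc) mulf_eq0 (negbTE z0) (negbTE w0).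
rewrite !andbF !orbF real_complex_eq0 mulf_eq0 !pospart_eq0 => h; exfalso.
by case/orP: h; lra.
Qed.

Lemma conjc_realX (s : R) k : conjc s%:C ^+ k = (s ^+ k)%:C.
Proof. by rewrite conjc_real rmorphXn. Qed.

Lemma lin_eq0 (p q : R) (x : R[i]) :
  0 < p -> 0 <= q -> p%:C * x + q%:C = 0 -> x = - (q / p)%:C.
Proof.
move=> p0 q0 h; have pC : p%:C != 0 by rewrite real_complex_eq0 gt_eqF.
apply: (mulfI pC); rewrite mulrN -rmorphM /= mulrCA divff ?gt_eqF // mulr1.
by apply/eqP; rewrite -addr_eq0 h.
Qed.

Lemma mul_eq0_cancel (x u : R[i]) : x != 0 -> x * u = 0 -> u = 0.
Proof. by move=> x0 /eqP; rewrite mulf_eq0 (negbTE x0) => /eqP. Qed.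

(** For a positive parameter all powers of l are positive factors, and the
five intervals of W / N are the five triangles of the triangulation. *)
Lemma nullhtpy_neq0 z w (s t : R) : 0 < s -> 0 < t ->
  nullhtpy1 z w s%:C t = 0 -> nullhtpy2 z w s%:C t = 0 -> False.
Proof.
move=> s0 t0; rewrite /nullhtpy1 /nullhtpy2 !conjc_realX.
have d0 : (0 < d)%N by case: d d_odd.
have -> : (s ^+ y2)%:C * s%:C ^+ y1 = (s ^+ y2 * s ^+ y1)%:C.
  by rewrite rmorphM !rmorphXn.
have WE : (sqmod w ^+ y)%:C = w ^+ y * conjc w ^+ y.
  by rewrite rmorphXn /= sqmodE exprMn.
move: WE; have := sqmod_eq0 w; have := sqmod_ge0 w; have := sqmod_ge0 z.
move: (sqmod w) (sqmod z) => W Z Z_ge0 W_ge0 w_eq WE.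
have N0 : 0 < Z + t by rewrite ltr_wpDl.
move: (Z + t) N0 => N N0.
have c1 : 0 < s ^+ y2 * s ^+ y1 by rewrite mulr_gt0 ?exprn_gt0.
have c2 : 0 < s ^+ y2 by rewrite exprn_gt0.
have c3 : 0 < s ^+ d2 by rewrite exprn_gt0.
have c4 : 0 < s ^+ (d2 + d1) by rewrite exprn_gt0.
move: (s ^+ y2 * s ^+ y1) c1 => c1 c1p; move: (s ^+ y2) c2 => c2 c2p.
move: (s ^+ d2) c3 (s ^+ (d2 + d1)) c4 => c3 c3p c4 c4p.
have [hW|hW] := ltP W N.
  (* triangle (w~^y, 1), (z^y, 0), (1, 1): the second component is positive *)
  rewrite (@pospart_le0 _ (W - 4 * N)); last lra.
  rewrite (@pospart_le0 _ (W - 2 * N)); last lra.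
  rewrite (@pospart_le0 _ (W - N)); last lra.
  rewrite mulr0 !mul0r !add0r (pospart_gt0 (a := 3 * N - W)); last lra.
  rewrite (pospart_gt0 (a := N - W)); last lra.
  move=> _ /eqP; rewrite -rmorphM /= real_complex_eq0 mulf_eq0 gt_eqF //= => /eqP; lra.
have w0 : w != 0 by rewrite -w_eq gt_eqF; lra.
have wc : conjc w != 0 by rewrite conjc_eq0.
rewrite (@pospart_le0 _ (N - W)) ?addr0; last lra.
have [hA|hA] := ltP W (2 * N).
  (* triangle (0, (z w)^d), (z^y, 0), (w~^y, 1): at a zero, both (z w)^d and,
     after multiplication of the first component by w^y, (z w)^y are negative *)
  rewrite (@pospart_le0 _ (W - 3 * N)) ?mul0r ?add0r; last lra.
  rewrite (@pospart_le0 _ (W - 4 * N)) ?mul0r ?add0r; last lra.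
  rewrite (@pospart_le0 _ (W - 2 * N)) ?mul0r ?add0r; last lra.
  rewrite (pospart_gt0 (a := 3 * N - W)); last lra.
  rewrite (pospart_gt0 (a := 2 * N - W)); last lra.
  rewrite (pospart_gt0 (a := 4 * N - W)); last lra.
  move=> h1 h2.
  set b := (4 * N - W) * pospart (W - N) * c4.
  have {}h2 : b%:C * (z * w) ^+ d + (t * (3 * N - W))%:C = 0.
    by rewrite -h2 /b !rmorphM /=; ring.
  have b_ge0 : 0 <= b by rewrite !mulr_ge0 ?pospart_ge0 //; lra.
  have q0 : 0 < t * (3 * N - W) by rewrite mulr_gt0 //; lra.
  have b0 : 0 < b.
    rewrite lt_def b_ge0 andbT; apply/eqP => b0; move: h2.
    by rewrite b0 mul0r add0r => /eqP; rewrite real_complex_eq0 gt_eqF.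
  have zwd := lin_eq0 b0 (ltW q0) h2.
  have W0 : 0 < W by lra.
  have p0 : 0 < (2 * N - W) * c2 by rewrite mulr_gt0 //; lra.
  have {}h1 : ((2 * N - W) * c2)%:C * (z * w) ^+ y + (t * (3 * N - W) * W ^+ y)%:C = 0.
    have := congr1 (fun x => x * w ^+ y) h1; rewrite mul0r => <-.
    by rewrite !rmorphM /= WE exprMn; ring.
  have q1 : 0 < t * (3 * N - W) * W ^+ y by rewrite mulr_gt0 ?exprn_gt0.
  have zwy := lin_eq0 p0 (ltW q1) h1.
  by apply: (no_common_negative_power y_even d_odd _ _ zwy zwd); rewrite divr_gt0.
have [hB|hB] := ltP W (3 * N).
  (* triangle (0, (z w)^d), (w~^y, w^d), (w~^y, 1): the first component is a
     positive multiple of w~^y *)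
  rewrite (@pospart_le0 _ (W - 3 * N)) ?mul0r ?add0r; last lra.
  rewrite (@pospart_le0 _ (2 * N - W)) ?mul0r ?add0r; last lra.
  rewrite (pospart_gt0 (a := 3 * N - W)); last lra.
  have := pospart_ge0 (W - 2 * N) => p_ge0 /eqP.
  rewrite !mulf_eq0 !real_complex_eq0 expf_eq0 (negbTE wc) andbF orbF gt_eqF //=.
  by move=> /eqP h _; lra.
rewrite (@pospart_le0 _ (2 * N - W)) ?mul0r ?add0r; last lra.
rewrite (@pospart_le0 _ (3 * N - W)); last lra.
rewrite (pospart_gt0 (a := W - 2 * N)); last lra.
rewrite !addr0.
have [hC|hC] := ltP W (4 * N).
  (* triangle ((z w~)^y, 0), (0, (z w)^d), (w~^y, w^d): at a zero, both z^y and
     z^d are negative *)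
  rewrite (@pospart_le0 _ (W - 4 * N)) ?mul0r ?add0r; last lra.
  rewrite (pospart_gt0 (a := 4 * N - W)); last lra.
  rewrite (pospart_gt0 (a := W - N)); last lra.
  move=> h1 h2.
  have q0 : 0 < t * (W - 2 * N) by rewrite mulr_gt0 //; lra.
  have b0 : 0 < (4 * N - W) * (W - N) * c4 by rewrite !mulr_gt0 //; lra.
  have {}h2 : ((4 * N - W) * (W - N) * c4)%:C * z ^+ d + (t * (W - 2 * N))%:C = 0.
    have h : w ^+ d * (((4 * N - W) * (W - N) * c4)%:C * z ^+ d
                       + (t * (W - 2 * N))%:C) = 0.
      by rewrite -h2 exprMn !rmorphM /=; ring.
    exact: (mul_eq0_cancel (expf_neq0 d w0) h).
  have zd := lin_eq0 b0 (ltW q0) h2.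
  set a := pospart (W - 3 * N) * c1.
  have {}h1 : a%:C * z ^+ y + (t * (W - 2 * N))%:C = 0.
    have h : conjc w ^+ y * (a%:C * z ^+ y + (t * (W - 2 * N))%:C) = 0.
      by rewrite -h1 exprMn /a !rmorphM /=; ring.
    exact: (mul_eq0_cancel (expf_neq0 y wc) h).
  have a_ge0 : 0 <= a by rewrite mulr_ge0 ?pospart_ge0 // ltW.
  have a0 : 0 < a.
    rewrite lt_def a_ge0 andbT; apply/eqP => a0; move: h1.
    by rewrite a0 mul0r add0r => /eqP; rewrite real_complex_eq0 gt_eqF.
  have zy := lin_eq0 a0 (ltW q0) h1.
  by apply: (no_common_negative_power y_even d_odd _ _ zy zd); rewrite divr_gt0.
(* triangle (0, w^d), ((z w~)^y, 0), (w~^y, w^d): the second component is a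
   positive multiple of w^d *)
rewrite (@pospart_le0 _ (4 * N - W)) ?mul0r ?addr0; last lra.
move=> _ h2.
have /eqP : ((pospart (W - 4 * N) * c3 + t * (W - 2 * N))%:C * w ^+ d) = 0.
  by rewrite -h2 rmorphD !rmorphM /=; ring.
rewrite mulf_eq0 expf_eq0 (negbTE w0) andbF orbF real_complex_eq0 => /eqP.
have : 0 <= pospart (W - 4 * N) * c3 by rewrite mulr_ge0 ?pospart_ge0 // ltW.
have : 0 < t * (W - 2 * N) by rewrite mulr_gt0 //; lra.
lra.
Qed.

End Core.

(** * Continuity of complex-valued functions *)

Section ComplexContinuity.
Variables (R : realType) (T : topologicalType).
Implicit Types (f g : T -> R[i]) (a b : T -> R).

(** The topology of R[i] is used only through real and imaginary parts. *)
Definition ccont f :=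
  continuous (fun p => Re (f p)) /\ continuous (fun p => Im (f p)).

Lemma rcont_cst (c : R) : continuous (fun _ : T => c).
Proof. by move=> p; exact: cvg_cst. Qed.
Lemma rcontD a b : continuous a -> continuous b -> continuous (fun p => a p + b p).
Proof. by move=> ha hb p; apply: continuousD; [exact: ha|exact: hb]. Qed.
Lemma rcontN a : continuous a -> continuous (fun p => - a p).
Proof. by move=> ha p; apply: continuousN; exact: ha. Qed.
Lemma rcontB a b : continuous a -> continuous b -> continuous (fun p => a p - b p).
Proof. by move=> ha hb; apply: rcontD => //; exact: rcontN. Qed.
Lemma rcontM a b : continuous a -> continuous b -> continuous (fun p => a p * b p).
Proof. by move=> ha hb p; apply: continuousM; [exact: ha|exact: hb]. Qed.
Lemma rcont_pospart a : continuous a -> continuous (fun p => pospart (a p)).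
Proof. by move=> ha p; apply: continuous_max; [exact: cvg_cst|exact: ha]. Qed.
Lemma rcont_norm a : continuous a -> continuous (fun p => `|a p|).
Proof. by move=> ha p; apply: continuous_comp; [exact: ha|exact: norm_continuous]. Qed.
Lemma rcont_prod (I : Type) (r : seq I) (P : pred I) (F : I -> T -> R) :
  (forall i, continuous (F i)) -> continuous (fun p => \prod_(i <- r | P i) F i p).
Proof.
move=> hF; elim: r => [|i r IH].
  by under eq_fun do rewrite big_nil; exact: rcont_cst.
under eq_fun do rewrite big_cons; case: (P i) => //; exact: rcontM.
Qed.

Lemma ccont_cst (c : R[i]) : ccont (fun _ => c).
Proof. by split; exact: rcont_cst. Qed.
Lemma ccont_real a : continuous a -> ccont (fun p => (a p)%:C).
Proof. by move=> ha; split=> //=; exact: rcont_cst. Qed.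
Lemma ccontD f g : ccont f -> ccont g -> ccont (fun p => f p + g p).
Proof.
move=> [f1 f2] [g1 g2].
split; [under eq_fun do rewrite raddfD /=|under eq_fun do rewrite raddfD /=].
exact: rcontD. exact: rcontD.
Qed.
Lemma Re_mulc (x z : R[i]) : Re (x * z) = Re x * Re z - Im x * Im z.
Proof. by case: x; case: z. Qed.
Lemma Im_mulc (x z : R[i]) : Im (x * z) = Re x * Im z + Im x * Re z.
Proof. by case: x => a b; case: z => c d /=; rewrite mulrC addrC [b * c]mulrC addrC. Qed.
Lemma ccontM f g : ccont f -> ccont g -> ccont (fun p => f p * g p).
Proof.
move=> [f1 f2] [g1 g2]; split.
  by under eq_fun do rewrite Re_mulc; apply: rcontB; exact: rcontM.
by under eq_fun do rewrite Im_mulc; apply: rcontD; exact: rcontM.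
Qed.
Lemma ccontJ f : ccont f -> ccont (fun p => conjc (f p)).
Proof.
have E1 (x : R[i]) : Re (conjc x) = Re x by case: x.
have E2 (x : R[i]) : Im (conjc x) = - Im x by case: x.
by move=> [f1 f2]; split; [under eq_fun do rewrite E1|under eq_fun do rewrite E2; exact: rcontN].
Qed.
Lemma ccontN f : ccont f -> ccont (fun p => - f p).
Proof.
move=> h; under eq_fun do rewrite -mulN1r; apply: ccontM => //; exact: ccont_cst.
Qed.
Lemma ccontX f k : ccont f -> ccont (fun p => f p ^+ k).
Proof.
move=> hf; elim: k => [|k IH]; first by under eq_fun do rewrite expr0; exact: ccont_cst.
by under eq_fun do rewrite exprS; exact: ccontM.
Qed.
Lemma ccont_sum (I : Type) (r : seq I) (P : pred I) (F : I -> T -> R[i]) :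
  (forall i, ccont (F i)) -> ccont (fun p => \sum_(i <- r | P i) F i p).
Proof.
move=> hF; elim: r => [|i r IH].
  by under eq_fun do rewrite big_nil; exact: ccont_cst.
under eq_fun do rewrite big_cons; case: (P i) => //; exact: ccontD.
Qed.
Lemma rcont_sqmod f : ccont f -> continuous (fun p => sqmod (f p)).
Proof. by move=> [f1 f2]; apply: rcontD; under eq_fun do rewrite expr2; exact: rcontM. Qed.

End ComplexContinuity.

(** The rules are selected by matching on syntax, since unification modulo
conversion could apply the rule for powers to any function. *)
Ltac cont_step := match goal with
  | |- ccont (fun p => @?f p + @?g p) => apply: (@ccontD _ _ f g)
  | |- ccont (fun p => @?f p * @?g p) => apply: (@ccontM _ _ f g)
  | |- ccont (fun p => - @?f p) => apply: (@ccontN _ _ f)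
  | |- ccont (fun p => @?f p ^+ ?k) => apply: (@ccontX _ _ f k)
  | |- ccont (fun p => conjc (@?f p)) => apply: (@ccontJ _ _ f)
  | |- ccont (fun p => (@?a p)%:C) => apply: (@ccont_real _ _ a)
  | |- ccont (fun _ => ?c) => exact: ccont_cst
  | |- continuous (fun p => pospart (@?a p)) => apply: (@rcont_pospart _ _ a)
  | |- continuous (fun p => sqmod (@?f p)) => apply: (@rcont_sqmod _ _ f)
  | |- continuous (fun p => @?a p + @?b p) => apply: (@rcontD _ _ a b)
  | |- continuous (fun p => @?a p * @?b p) => apply: (@rcontM _ _ a b)
  | |- continuous (fun p => - @?a p) => apply: (@rcontN _ _ a)
  | |- continuous (fun p => `|@?a p|) => apply: (@rcont_norm _ _ a)
  | |- continuous (fun _ => ?c) => exact: rcont_cst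
  | _ => assumption
  end.

(** * Continuity and equivariance of the null-homotopy *)

Section CoreProps.
Variables (R : realType) (y y1 y2 d d1 d2 r1 r2 : nat).
Implicit Types (z w l : R[i]) (t : R).
Local Notation nullhtpy1 := (@nullhtpy1 R y y1 y2).
Local Notation nullhtpy2 := (@nullhtpy2 R d d1 d2).

Lemma nullhtpy1_cont (T : topologicalType) (z w l : T -> R[i]) (t : T -> R) :
  ccont z -> ccont w -> ccont l -> continuous t ->
  ccont (fun p => nullhtpy1 (z p) (w p) (l p) (t p)).
Proof.
move=> hz hw hl ht; rewrite /nullhtpy1.
by repeat cont_step.
Qed.

Lemma nullhtpy2_cont (T : topologicalType) (z w l : T -> R[i]) (t : T -> R) :
  ccont z -> ccont w -> ccont l -> continuous t ->
  ccont (fun p => nullhtpy2 (z p) (w p) (l p) (t p)).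
Proof.
move=> hz hw hl ht; rewrite /nullhtpy2.
by repeat cont_step.
Qed.

Lemma nullhtpy1J z w l t :
  nullhtpy1 (conjc z) (conjc w) (conjc l) t = conjc (nullhtpy1 z w l t).
Proof.
by rewrite /nullhtpy1 !sqmodJ !(rmorphD, rmorphM, rmorphXn) /= !oppr0.
Qed.

Lemma nullhtpy2J z w l t :
  nullhtpy2 (conjc z) (conjc w) (conjc l) t = conjc (nullhtpy2 z w l t).
Proof.
by rewrite /nullhtpy2 !sqmodJ !(rmorphD, rmorphM, rmorphXn) /= !oppr0.
Qed.

Hypotheses (yE1 : y = (r2 * y1)%N) (yE2 : y = (r1 * y2).+1).
Hypotheses (dE1 : d = (r1 * d1)%N) (dE2 : d = (r2 * d2).+1).
Variables (a b c : R[i]).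
Hypotheses (a1 : a * conjc a = 1) (b1 : b * conjc b = 1) (c1 : c * conjc c = 1).
Hypotheses (acE : c = a ^+ r1) (bcE : c = b ^+ r2).

Lemma sqmod_unit (u z : R[i]) : u * conjc u = 1 -> sqmod (u * z) = sqmod z.
Proof.
move=> u1; rewrite sqmodM (_ : sqmod u = 1) ?mul1r //.
by apply: complexI; rewrite sqmodE u1.
Qed.

(** Here a, b, c stand for the action of x on V_k1, V_k2, V_k.  The two ways of
writing y turn a^y into a times a power of c, and conj(b)^y into a power of
conj(c); the powers of l compensate these powers of c. *)
Lemma nullhtpy1_rot z w l :
  nullhtpy1 (a * z) (b * w) (c * l) 0 = a * nullhtpy1 z w l 0.
Proof.
have cX k : c ^+ k * conjc c ^+ k = 1 by rewrite -exprMn c1 expr1n.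
have ay : a ^+ y = a * c ^+ y2 by rewrite yE2 exprS exprM -acE.
have by_ : conjc b ^+ y = conjc c ^+ y1.
  by rewrite yE1 exprM -rmorphXn /= -bcE.
rewrite /nullhtpy1 !sqmod_unit // !mul0r !addr0 !rmorphM /= !exprMn ay by_.
rewrite [RHS]mulrDr; congr (_ + _).
  rewrite -[RHS]mul1r -(cX y1) -[in RHS](mul1r a) -(cX y2); ring.
rewrite -[RHS]mul1r -(cX y2); ring.
Qed.

Lemma nullhtpy2_rot z w l :
  nullhtpy2 (a * z) (b * w) (c * l) 0 = b * nullhtpy2 z w l 0.
Proof.
have cX k : c ^+ k * conjc c ^+ k = 1 by rewrite -exprMn c1 expr1n.
have ad : a ^+ d = c ^+ d1 by rewrite dE1 exprM -acE.
have bd : b ^+ d = b * c ^+ d2 by rewrite dE2 exprS exprM -bcE.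
rewrite /nullhtpy2 !sqmod_unit // !mul0r !addr0 !rmorphM /= !exprMn ad bd.
rewrite [RHS]mulrDr !exprD; congr (_ + _).
  rewrite -[RHS]mul1r -(cX d2); ring.
rewrite -[RHS]mul1r -(cX d2) -[in RHS](mul1r b) -(cX d1); ring.
Qed.

End CoreProps.

(** * Bump functions around the orbit of 1 in the plane V_1 *)

Section Spread.
Variables (R : realType) (n : nat) (om : R[i]).
Hypotheses (n_odd : odd n) (om_prim : n.-primitive_root om).
Hypothesis om_unit : om * conjc om = 1.
Local Notation nu := (conjc om).
Implicit Types (e l : R[i]).

(** Positive exactly where 1 is the only one among the n-th roots of unity that
maximizes the inner product with e; the n rotated copies therefore have
disjoint supports. *)
Definition arc_bump e : R := \prod_(1 <= j < n) pospart (Re e - Re (om ^+ j * e)).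
(** Zero on the nonpositive reals, and not zero at both l and -l unless l = 0
([slit_bump_cover]). *)
Definition slit_bump l : R := pospart (Re l + `|Im l|).

Lemma root_mul_conjX j : om ^+ j * nu ^+ j = 1.
Proof. by rewrite -exprMn om_unit expr1n. Qed.

Lemma conjc_rootX j : (j <= n)%N -> nu ^+ j = om ^+ (n - j).
Proof.
move=> jn; rewrite -[LHS]mul1r -(prim_expr_order om_prim) -{1}(subnK jn) exprD.
by rewrite -mulrA root_mul_conjX mulr1.
Qed.

Lemma Re_conjc e : Re (conjc e) = Re e. Proof. by case: e. Qed.
Lemma Im_conjc e : Im (conjc e) = - Im e. Proof. by case: e. Qed.

Lemma unit_root_neq0 : om != 0.
Proof. by apply/eqP => o; have := om_unit; rewrite o mul0r => /esym/eqP; rewrite oner_eq0. Qed.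

Lemma conjc_root_modn m : nu ^+ (m %% n) = nu ^+ m.
Proof.
have nun : nu ^+ n = 1 by rewrite conjc_rootX // subnn.
by rewrite [in RHS](divn_eq m n) exprD mulnC exprM nun expr1n mul1r.
Qed.

Lemma arc_bump_ge0 e : 0 <= arc_bump e.
Proof. by apply: prodr_ge0 => j _; exact: pospart_ge0. Qed.

Lemma arc_bump_neq0P e :
  reflect (forall j, (0 < j < n)%N -> Re (om ^+ j * e) < Re e) (arc_bump e != 0).
Proof.
apply: (iffP idP) => [|h].
  rewrite prodf_seq_neq0 => /allP h j; rewrite -mem_index_iota => /h.
  by rewrite pospart_eq0 subr_le0 -ltNge.
rewrite prodf_seq_neq0; apply/allP => j; rewrite mem_index_iota => /h.
by rewrite pospart_eq0 subr_le0 -ltNge.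
Qed.

Lemma arc_bumpJ e : arc_bump (conjc e) = arc_bump e.
Proof.
rewrite /arc_bump big_nat_rev /=; apply: eq_big_nat => j /andP[j1 jn].
congr pospart; congr (_ - _); first exact: Re_conjc.
rewrite addSn subSS add0n -conjc_rootX 1?ltnW // -rmorphXn -rmorphM /=.
exact: Re_conjc.
Qed.

Lemma arc_bump_disjoint c c' e : (c < n)%N -> (c' < n)%N ->
  arc_bump (nu ^+ c * e) != 0 -> arc_bump (nu ^+ c' * e) != 0 -> c = c'.
Proof.
wlog: c c' / (c <= c')%N => [th|].
  by case/orP: (leq_total c c') => [cc|cc] *; [apply: th|apply/esym/th].
rewrite leq_eqVlt => /orP[/eqP //|cc'] cn cn' /arc_bump_neq0P h /arc_bump_neq0P h'.
have := h' (c' - c)%N; have := h (n - (c' - c))%N.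
have E1 : om ^+ (n - (c' - c)) * (nu ^+ c * e) = nu ^+ c' * e.
  rewrite -conjc_rootX; last by lia.
  by rewrite mulrA -exprD subnK // ltnW.
have E2 : om ^+ (c' - c) * (nu ^+ c' * e) = nu ^+ c * e.
  rewrite -[in nu ^+ c'](subnK (ltnW cc')) exprD.
  by rewrite -mulrA mulrA root_mul_conjX mul1r.
rewrite E1 E2 => h1 h2.
have {}h1 : Re (nu ^+ c' * e) < Re (nu ^+ c * e) by apply: h1; lia.
have {}h2 : Re (nu ^+ c * e) < Re (nu ^+ c' * e) by apply: h2; lia.
by have := lt_trans h1 h2; rewrite ltxx.
Qed.

Lemma sqmod_root j e : sqmod (om ^+ j * e) = sqmod e.
Proof. by apply: sqmod_unit; rewrite rmorphXn /= root_mul_conjX. Qed.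

(** All other points of the circle of radius f have real part less than f. *)
Lemma arc_bump_real (f : R) : 0 < f -> arc_bump f%:C != 0.
Proof.
move=> f0; apply/arc_bump_neq0P => j /andP[j0 jn].
have := sqmod_root j f%:C; have : om ^+ j * f%:C != f%:C.
  rewrite -subr_eq0 -{2}[f%:C]mul1r -mulrBl mulf_neq0 ?subr_eq0 //.
    rewrite -(prim_expr_mod om_prim) -(expr0 om) (eq_prim_root_expr om_prim).
    by rewrite mod0n modn_mod modn_small // -lt0n.
  by rewrite real_complex_eq0 gt_eqF.
case: (om ^+ j * f%:C) => a b; rewrite eq_complex /sqmod /= expr0n addr0.
move=> /negP h E; rewrite ltNge; apply/negP => fa; apply: h.
have b0 : b ^+ 2 = 0.
  apply/eqP; rewrite eq_le sqr_ge0 andbT; nra.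
have /eqP b00 : b == 0 by rewrite -sqrf_eq0 b0.
rewrite b00 eqxx andbT; apply/eqP.
have : (a - f) * (a + f) = 0 by rewrite -subr_sqr; nra.
move/eqP; rewrite mulf_eq0 => /orP[|/eqP]; first by rewrite subr_eq0 => /eqP.
lra.
Qed.

Lemma conjc_rootK c e : nu ^+ c * (om ^+ c * e) = e.
Proof. by rewrite mulrA [nu ^+ c * _]mulrC root_mul_conjX mul1r. Qed.

(** The rotated copies of the bump at 1 and of the bump at -1 have no common
zero but 0.  If no copy of the first bump is positive at e, then two of the
roots of unity maximize the inner product with e, so that a symmetry axis of
the n-gon passes through e; as n is odd, this axis passes through an n-th root
of unity, and e is a real multiple of that root. *)
Lemma arc_bump_cover e : (forall c, (c < n)%N -> arc_bump (nu ^+ c * e) = 0) ->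
  (forall c, (c < n)%N -> arc_bump (- (nu ^+ c * e)) = 0) -> e = 0.
Proof.
move=> hp hn.
(* a positive rotated copy of e is seen by the first bump, a negative one by
   the second *)
have real_turn_eq0 j (f : R) : om ^+ j * e = f%:C -> f = 0.
  move=> ef.
  have [c cn cE] : exists2 c, (c < n)%N & nu ^+ c * e = f%:C.
    exists ((n - j %% n) %% n)%N; first by rewrite ltn_mod (odd_gt0 n_odd).
    rewrite -ef conjc_rootX; last by rewrite ltnW // ltn_mod (odd_gt0 n_odd).
    congr (_ * _); apply/eqP; rewrite (eq_prim_root_expr om_prim).
    have jn : (j %% n < n)%N by rewrite ltn_mod (odd_gt0 n_odd).
    have [->|j0] := posnP (j %% n)%N.
      by rewrite subn0 modnn subn0 modnn.
    rewrite (@modn_small (n - j %% n)); last by lia.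
    by rewrite subKn ?modn_mod // ltnW.
  have [f0|f0|//] := ltgtP 0 f.
    by have := arc_bump_real f0; rewrite -cE hp ?eqxx.
  have f0' : 0 < - f by rewrite oppr_gt0.
  by have := arc_bump_real f0'; rewrite rmorphN /= -cE hn ?eqxx.
have [c0 _ c0max] := @arg_maxP _ R 'I_n (Ordinal (odd_gt0 n_odd)) xpredT
   (fun c : 'I_n => Re (nu ^+ c * e)) isT.
set a := nu ^+ c0 * e.
have a0_e0 : a = 0 -> e = 0.
  by move=> /eqP; rewrite mulf_eq0 expf_eq0 conjc_eq0 (negbTE unit_root_neq0) andbF /= => /eqP.
have /eqP := hp _ (ltn_ord c0).
rewrite /arc_bump prodf_seq_eq0 => /hasP[j]; rewrite mem_index_iota => /andP[j0 jn] /=.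
rewrite pospart_eq0 subr_le0 -/a => le1.
have le2 : Re (om ^+ j * a) <= Re a.
  pose m := ((n - j) + c0)%N.
  have mn : (m %% n < n)%N by rewrite ltn_mod (odd_gt0 n_odd).
  have := c0max (Ordinal mn) isT; rewrite /= (_ : nu ^+ (m %% n) * e = om ^+ j * a) //.
  rewrite -(subKn (ltnW jn)) -conjc_rootX ?leq_subr // /a mulrA -exprD -/m.
  by rewrite conjc_root_modn.
have ReE : Re (om ^+ j * a) = Re a by apply/eqP; rewrite eq_le le1 le2.
have : (Im (om ^+ j * a) - Im a) * (Im (om ^+ j * a) + Im a) = 0.
  by have := sqmod_root j a; rewrite /sqmod ReE -subr_sqr => /addrI ->; rewrite subrr.
move/eqP; rewrite mulf_eq0 subr_eq0 addr_eq0 => /orP[/eqP ImE|/eqP ImE].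
  apply: a0_e0; have : (om ^+ j - 1) * a = 0.
    by rewrite mulrBl mul1r; apply/eqP; rewrite subr_eq0 eq_complex ReE ImE !eqxx.
  move/eqP; rewrite mulf_eq0 => /orP[|/eqP //].
  rewrite subr_eq0 -(expr0 om) (eq_prim_root_expr om_prim) mod0n modn_small //.
  by rewrite eqn0Ngt j0.
(* half of j modulo the odd number n, so that om^m is a square root of om^j *)
pose m := (j * n.+1./2)%N.
have m2 : om ^+ m * om ^+ m = om ^+ j.
  rewrite -exprD addnn -muln2 -mulnA muln2 halfK /= n_odd subn0 mulnS exprD.
  by rewrite mulnC exprM (prim_expr_order om_prim) expr1n mulr1.
have fJ : conjc (om ^+ m * a) = om ^+ m * a.
  have -> : conjc (om ^+ m * a) = nu ^+ m * conjc a by rewrite rmorphM rmorphXn.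
  have -> : conjc a = om ^+ j * a.
    by apply/eqP; rewrite eq_complex Re_conjc Im_conjc ReE ImE !eqxx.
  by rewrite -m2 -mulrA conjc_rootK.
have fr : om ^+ m * a = (Re (om ^+ m * a))%:C.
  apply/eqP; rewrite eq_complex eqxx /=; have := congr1 (fun u => Im u) fJ.
  by rewrite Im_conjc => h; apply/eqP; lra.
have := @real_turn_eq0 (m + (n - c0))%N (Re (om ^+ m * a)).
rewrite exprD -mulrA -conjc_rootX; last exact: ltnW.
rewrite -/a => /(_ fr) f0; move: fr; rewrite f0 => /eqP.
by rewrite mulf_eq0 expf_eq0 (negbTE unit_root_neq0) andbF /= => /eqP.
Qed.
End Spread.

(** * Spreading a homotopy over an orbit *)

Lemma sum_shift (V : nmodType) n (F : nat -> V) : F n = F 0%N ->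
  \sum_(c < n) F c.+1 = \sum_(c < n) F c.
Proof.
case: n => [|m] E; first by rewrite !big_ord0.
by rewrite big_ord_recr /= [RHS]big_ord_recl /= addrC E.
Qed.

Section SpreadMap.
Variables (R : realType) (n : nat) (om : R[i]).
Hypotheses (n_odd : odd n) (om_prim : n.-primitive_root om).
Hypothesis om_unit : om * conjc om = 1.
Local Notation nu := (conjc om).
Local Notation arc_bump := (arc_bump n om).
Implicit Types (e l : R[i]) (u : bool -> R[i]).

Lemma arc_bump_cont (T : topologicalType) (e : T -> R[i]) :
  ccont e -> continuous (fun p => arc_bump (e p)).
Proof.
move=> [e1 e2]; apply: rcont_prod => j; apply: rcont_pospart; apply: rcontB => //.
by have [] : ccont (fun p => om ^+ j * e p) by repeat cont_step; split.
Qed.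

Lemma slit_bump_cont (T : topologicalType) (l : T -> R[i]) :
  ccont l -> continuous (fun p => slit_bump (l p)).
Proof. by move=> [l1 l2]; apply: rcont_pospart; apply: rcontD => //; exact: rcont_norm. Qed.

(** H is a homotopy, with time s, that is equivariant for the whole group at
s = 0 and commutes with the conjugation at all times.  Its two components and
the weights of the two planes are indexed by bool. *)
Variables (wt : bool -> nat) (k : nat).
Variable H : (bool -> R[i]) -> R[i] -> R -> bool -> R[i].
Hypothesis H_cont : forall (T : topologicalType) (u : bool -> T -> R[i])
    (l : T -> R[i]) (s : T -> R),
  (forall b, ccont (u b)) -> ccont l -> continuous s ->
  forall b, ccont (fun p => H (u^~ p) (l p) (s p) b).
Hypothesis H_conj : forall u l s b,
  H (fun b => conjc (u b)) (conjc l) s b = conjc (H u l s b).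
Hypothesis H_rot : forall u l b,
  H (fun b => om ^+ wt b * u b) (om ^+ k * l) 0 b = om ^+ wt b * H u l 0 b.
Hypothesis H_eq0 : forall u l s, l != 0 -> 0 <= s ->
  (s != 0 -> 0 < Re l + `|Im l|) -> (forall b, H u l s b = 0) ->
  (forall b, u b = 0) /\ s = 0.

(** The homotopy H conjugated by x^c; its time depends on the bump at om^c, and
on the position of the rotated parameter l, so that it is 0 when H may vanish
at positive times. *)
Definition turned u l e (b : bool) (c : nat) : R[i] :=
  om ^+ (c * wt b) * H (fun b => nu ^+ (c * wt b) * u b) (nu ^+ (c * k) * l)
    (arc_bump (nu ^+ c * e) * slit_bump (nu ^+ (c * k) * l)) b.

(** At time 0 all rotated copies of H agree, and at most one of them has a
nonzero time; so the sum selects this copy, and it is visibly continuous. *)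
Definition spread u l e (b : bool) : R[i] :=
  H u l 0 b + \sum_(c < n) (turned u l e b c - H u l 0 b).

Lemma spread_cont (T : topologicalType) (u : bool -> T -> R[i]) (l e : T -> R[i]) :
  (forall b, ccont (u b)) -> ccont l -> ccont e ->
  forall b, ccont (fun p => spread (u^~ p) (l p) (e p) b).
Proof.
move=> hu hl he b.
have h0 : ccont (fun p => H (u^~ p) (l p) 0 b).
  by apply: (H_cont (s := fun=> 0)) => //; exact: rcont_cst.
apply: ccontD => //; apply: ccont_sum => c; apply: ccontD; last exact: ccontN.
apply: ccontM; first exact: ccont_cst.
apply: (H_cont (u := fun b p => nu ^+ (c * wt b) * u b p)
   (l := fun p => nu ^+ (c * k) * l p)
   (s := fun p => arc_bump (nu ^+ c * e p) * slit_bump (nu ^+ (c * k) * l p))).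
- by move=> b'; apply: ccontM => //; exact: ccont_cst.
- by apply: ccontM => //; exact: ccont_cst.
apply: rcontM.
  by apply: arc_bump_cont; apply: ccontM => //; exact: ccont_cst.
by apply: slit_bump_cont; apply: ccontM => //; exact: ccont_cst.
Qed.

Lemma root_exprn_mul m : om ^+ (n * m) = 1.
Proof. by rewrite exprM (prim_expr_order om_prim) expr1n. Qed.

Lemma turned_n u l e b : turned u l e b n = turned u l e b 0.
Proof.
have nuE m : nu ^+ (n * m) = 1 by rewrite -rmorphXn root_exprn_mul rmorph1.
rewrite /turned !mul0n root_exprn_mul !nuE !expr0 -[n in nu ^+ n]muln1 nuE.
congr (_ * H _ _ _ _); apply/funext => b'; by rewrite nuE.
Qed.

Lemma turned_rot u l e b c :
  turned (fun b => om ^+ wt b * u b) (om ^+ k * l) (om * e) b c.+1 =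
  om ^+ wt b * turned u l e b c.
Proof.
have shiftX (m : nat) (x : R[i]) : nu ^+ (c.+1 * m) * (om ^+ m * x) = nu ^+ (c * m) * x.
  by rewrite mulSn exprD -[RHS]mul1r -(root_mul_conjX om_unit m); ring.
rewrite /turned mulSn exprD -mulrA; congr (_ * (_ * _)).
have -> : nu ^+ c.+1 * (om * e) = nu ^+ c * e.
  by have := shiftX 1%N e; rewrite !muln1 expr1.
rewrite shiftX.
by congr (H _ _ _ _); apply/funext => b'; rewrite shiftX.
Qed.

Lemma turned_conj u l e b c : (c <= n)%N ->
  turned (fun b => conjc (u b)) (conjc l) (conjc e) b c =
  conjc (turned u l e b (n - c)).
Proof.
move=> cn.
have E m : om ^+ (c * m) = nu ^+ ((n - c) * m).
  by rewrite !exprM (conjc_rootX om_prim om_unit (leq_subr c n)) subKn.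
have E' m : nu ^+ (c * m) = conjc (nu ^+ ((n - c) * m)).
  by rewrite -E rmorphXn.
have Ec : nu ^+ c = conjc (nu ^+ (n - c)) by have := E' 1%N; rewrite !muln1.
have thJ x : slit_bump (conjc x) = slit_bump x by rewrite /slit_bump Re_conjc Im_conjc normrN.
rewrite /turned E' E Ec -!rmorphM /= arc_bumpJ // thJ.
rewrite [RHS]rmorphM rmorphXn /= -H_conj.
congr (_ * H _ _ _ _); apply/funext => b'.
by rewrite E' -rmorphM.
Qed.

(** Rotating the arguments permutes the copies cyclically, and conjugating
them reverses the cyclic order. *)
Lemma spread_rot u l e b :
  spread (fun b => om ^+ wt b * u b) (om ^+ k * l) (om * e) b =
  om ^+ wt b * spread u l e b.
Proof.
rewrite /spread H_rot mulrDr; congr (_ + _); rewrite mulr_sumr.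
rewrite -(@sum_shift _ n (fun c => turned _ _ _ b c - _)); last by rewrite turned_n.
by apply: eq_bigr => c _; rewrite turned_rot mulrBr.
Qed.

Lemma spread_conj u l e b :
  spread (fun b => conjc (u b)) (conjc l) (conjc e) b = conjc (spread u l e b).
Proof.
rewrite /spread H_conj rmorphD rmorph_sum; congr (_ + _).
rewrite -(@sum_shift _ n (fun c => turned _ _ _ b c - _)); last by rewrite turned_n.
rewrite [RHS](reindex_inj rev_ord_inj) /=.
by apply: eq_bigr => c _; rewrite turned_conj ?ltn_ord // rmorphB.
Qed.

Lemma turned0 u l b c : om ^+ (c * wt b) *
  H (fun b => nu ^+ (c * wt b) * u b) (nu ^+ (c * k) * l) 0 b = H u l 0 b.
Proof.
elim: c => [|c IH].
  rewrite !mul0n !expr0 !mul1r; congr (H _ _ _ _).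
  by apply/funext => b'; rewrite ?mul0n ?expr0 mul1r.
have shiftX (m : nat) (x : R[i]) : om ^+ m * (nu ^+ (c.+1 * m) * x) = nu ^+ (c * m) * x.
  by rewrite mulSn exprD !mulrA (root_mul_conjX om_unit) mul1r.
rewrite -[RHS]IH mulSn exprD [om ^+ wt b * _]mulrC -mulrA -H_rot shiftX.
by congr (_ * H _ _ _ _); apply/funext => b'; rewrite shiftX.
Qed.

Lemma spread_eq0 u l e : l != 0 -> (forall b, spread u l e b = 0) ->
  (forall b, u b = 0) /\
  forall c, (c < n)%N -> arc_bump (nu ^+ c * e) * slit_bump (nu ^+ (c * k) * l) = 0.
Proof.
move=> l0 h.
have turn_trivial c b : arc_bump (nu ^+ c * e) * slit_bump (nu ^+ (c * k) * l) = 0 ->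
    turned u l e b c - H u l 0 b = 0.
  by move=> E; rewrite /turned E turned0 subrr.
have [[c s0]|none] := pselect (exists c : 'I_n,
    arc_bump (nu ^+ c * e) * slit_bump (nu ^+ (c * k) * l) != 0).
  exfalso.
  have E b : spread u l e b = turned u l e b c.
    rewrite /spread (bigD1 c) //= big1 ?addr0 ?subrKC // => c' cc'.
    apply: turn_trivial; apply/eqP; rewrite mulf_eq0; apply/orP; left.
    apply/negPn/negP => p0; move/eqP: cc'; apply; apply/val_inj => /=.
    move: s0; rewrite mulf_eq0 negb_or => /andP[p1 _].
    exact: (arc_bump_disjoint n_odd om_prim om_unit (ltn_ord c') (ltn_ord c) p0 p1).
  set s := _ * _ in s0.
  have nu0 m : nu ^+ m != 0 by rewrite expf_neq0 // conjc_eq0 (unit_root_neq0 om_unit).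
  have := @H_eq0 (fun b => nu ^+ (c * wt b) * u b) (nu ^+ (c * k) * l) s.
  case.
  - by rewrite mulf_neq0.
  - by rewrite mulr_ge0 ?arc_bump_ge0 // pospart_ge0.
  - by rewrite mulf_eq0 negb_or => /andP[_]; rewrite pospart_eq0 -ltNge.
  - move=> b; have := h b; rewrite E /turned => /eqP.
    by rewrite mulf_eq0 expf_eq0 (negbTE (unit_root_neq0 om_unit)) andbF /= => /eqP.
  - by move=> _ s00; rewrite s00 eqxx in s0.
have s_eq0 c : (c < n)%N -> arc_bump (nu ^+ c * e) * slit_bump (nu ^+ (c * k) * l) = 0.
  move=> cn; apply/eqP/negPn/negP => s0; apply: none.
  by exists (Ordinal cn).
split=> //.
have [] // := @H_eq0 u l 0 l0 (lexx _); first by rewrite eqxx.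
move=> b; rewrite -[RHS](h b) /spread big1 ?addr0 // => c _.
exact/turn_trivial/s_eq0.
Qed.

End SpreadMap.

(** * Nonzero complex parameters *)

Section Contract.
Variables (R : realType) (y y1 y2 d d1 d2 r1 r2 : nat).
Implicit Types (l : R[i]) (u : bool -> R[i]) (s : R).

Definition nullhtpy u l t (b : bool) : R[i] :=
  if b then nullhtpy1 y y1 y2 (u true) (u false) l t
  else nullhtpy2 d d1 d2 (u true) (u false) l t.

Definition sqnorm u : R := sqmod (u true) + sqmod (u false).

(** For a parameter l that is not a nonpositive real.  While s <= |u|^2, the
parameter moves from |u|^2 l to |u|^2 on a segment, which avoids 0; the
null-homotopy starts only afterwards, with the positive parameter s.  At u = 0
the second stage is reached immediately, so that a positive time gives a
nonzero value there. *)
Definition param_nullhtpy u l s : bool -> R[i] :=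
  nullhtpy u ((pospart (sqnorm u - s))%:C * l + s%:C) (pospart (s - sqnorm u)).

Lemma sqnorm_ge0 u : 0 <= sqnorm u.
Proof. by rewrite addr_ge0 ?sqmod_ge0. Qed.

Lemma param_nullhtpy_cont (T : topologicalType) (u : bool -> T -> R[i])
    (l : T -> R[i]) (s : T -> R) :
  (forall b, ccont (u b)) -> ccont l -> continuous s ->
  forall b, ccont (fun p => param_nullhtpy (u^~ p) (l p) (s p) b).
Proof.
move=> hu hl hs b; have h1 := hu true; have h2 := hu false.
have hn : continuous (fun p => sqnorm (u^~ p)) by rewrite /sqnorm; repeat cont_step.
have hl' : ccont (fun p => (pospart (sqnorm (u^~ p) - s p))%:C * l p + (s p)%:C).
  by repeat cont_step.
have ht : continuous (fun p => pospart (s p - sqnorm (u^~ p))) by repeat cont_step.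
by case: b; [exact: nullhtpy1_cont | exact: nullhtpy2_cont].
Qed.

Lemma param_nullhtpy_conj u l s b :
  param_nullhtpy (fun b => conjc (u b)) (conjc l) s b = conjc (param_nullhtpy u l s b).
Proof.
rewrite /param_nullhtpy /sqnorm !sqmodJ -/(sqnorm u).
have -> (a : R) : a%:C * conjc l + s%:C = conjc (a%:C * l + s%:C).
  by rewrite rmorphD rmorphM /= !oppr0.
by case: b; [exact: nullhtpy1J | exact: nullhtpy2J].
Qed.

Hypotheses (yE1 : y = (r2 * y1)%N) (yE2 : y = (r1 * y2).+1).
Hypotheses (dE1 : d = (r1 * d1)%N) (dE2 : d = (r2 * d2).+1).
Hypotheses (y_even : ~~ odd y) (d_odd : odd d).

Lemma param_nullhtpy_rot (om : R[i]) (wt : bool -> nat) (k : nat) u l b :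
  om * conjc om = 1 -> k = (wt true * r1)%N -> k = (wt false * r2)%N ->
  param_nullhtpy (fun b => om ^+ wt b * u b) (om ^+ k * l) 0 b =
  om ^+ wt b * param_nullhtpy u l 0 b.
Proof.
move=> om1 k1 k2.
have omX m : om ^+ m * conjc (om ^+ m) = 1 by rewrite rmorphXn -exprMn om1 expr1n.
rewrite /param_nullhtpy /sqnorm !sqmod_unit // !addr0 !subr0 !sub0r.
rewrite -/(sqnorm u) (@pospart_le0 _ (- _)) ?oppr_le0 ?sqnorm_ge0 // mulrCA.
have e1 : om ^+ k = (om ^+ wt true) ^+ r1 by rewrite -exprM k1.
have e2 : om ^+ k = (om ^+ wt false) ^+ r2 by rewrite -exprM k2.
by case: b; rewrite /nullhtpy /= ?(nullhtpy1_rot yE1 yE2 _ _ _ e1 e2)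
  ?(nullhtpy2_rot dE1 dE2 _ _ _ e1 e2).
Qed.

Lemma param_nullhtpy_eq0 u l s : l != 0 -> 0 <= s ->
  (s != 0 -> 0 < Re l + `|Im l|) -> (forall b, param_nullhtpy u l s b = 0) ->
  (forall b, u b = 0) /\ s = 0.
Proof.
move=> l0 s0 ls h; have := h true; have := h false.
have y_gt0 : (0 < y)%N by rewrite yE2.
rewrite /param_nullhtpy /nullhtpy; set q := sqnorm u.
have q_eq0 : q = 0 -> forall b, u b = 0.
  move=> /eqP; rewrite paddr_eq0 ?sqmod_ge0 // !sqmod_eq0 => /andP[/eqP a /eqP b].
  by case.
have q_ge0 : 0 <= q := sqnorm_ge0 u.
have [qs|qs] := ltP q s.
  rewrite (pospart_gt0 (a := s - q)) ?subr_gt0 // pospart_le0; last lra.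
  rewrite mul0r add0r => h2 h1; exfalso.
  by apply: (nullhtpy_neq0 y_even d_odd _ _ h1 h2); lra.
rewrite (pospart_le0 (a := s - q)); last lra.
move=> h2 h1.
have [q0|q0] := eqVneq q 0; first by split; [exact: q_eq0 | lra].
have l'0 : (pospart (q - s))%:C * l + s%:C != 0.
  have [s00|s00] := eqVneq s 0.
    rewrite s00 subr0 addr0 mulf_neq0 // real_complex_eq0 pospart_eq0 -ltNge.
    by rewrite lt_def q0.
  have s_gt0 : 0 < s by rewrite lt_def s00.
  have := ls s00; case: (l) => a c /= ac; apply/negP; rewrite eq_complex /=.
  have := pospart_ge0 (q - s); set w := pospart _ => w0.
  rewrite !mul0r subr0 addr0 => /andP[/eqP e1 /eqP e2].
  have wa : w * a < 0 by lra.
  have w_gt0 : 0 < w by rewrite lt_def w0 andbT; apply/eqP => w00; move: wa; rewrite w00 mul0r ltxx.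
  have c0 : c = 0 by apply/eqP; move/eqP: e2; rewrite addr0 mulf_eq0 gt_eqF.
  by move: ac; rewrite c0 normr0 addr0 => ac; have := mulr_gt0 w_gt0 ac; lra.
have [z0 w0] := nullhtpy_eq0_start y_gt0 d_odd l'0 h1 h2.
by exfalso; move/eqP: q0; apply; rewrite /q /sqnorm z0 w0 /sqmod /= !expr0n /= !addr0.
Qed.

End Contract.

(** * Splitting one weight into several *)

Section Split.
Variables (R : realType) (n : nat) (om : R[i]).
Hypotheses (n_odd : odd n) (om_prim : n.-primitive_root om).
Hypothesis om_unit : om * conjc om = 1.
Variables (T : topologicalType) (tx ty : T -> T).

(** Equivariant functions to the plane V_k; tx and ty are the actions of x and
y on the source. *)
Definition weight_fun (k : nat) (f : T -> R[i]) :=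
  [/\ ccont f, forall p, f (tx p) = om ^+ k * f p & forall p, f (ty p) = conjc (f p)].

Lemma weight_fun0 k : weight_fun k (fun=> 0).
Proof. by split=> [|p|p]; [exact: ccont_cst | rewrite mulr0 | rewrite conjc0]. Qed.

Lemma weight_funN k f : weight_fun k f -> weight_fun k (fun p => - f p).
Proof.
move=> [h1 h2 h3]; split=> [|p|p]; first exact: ccontN.
  by rewrite h2 mulrN.
by rewrite h3 rmorphN.
Qed.

Section Data.
Variables (y y1 y2 d d1 d2 r1 r2 : nat) (wt : bool -> nat) (k : nat).
Hypotheses (yE1 : y = (r2 * y1)%N) (yE2 : y = (r1 * y2).+1).
Hypotheses (dE1 : d = (r1 * d1)%N) (dE2 : d = (r2 * d2).+1).
Hypotheses (y_even : ~~ odd y) (d_odd : odd d).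
Hypotheses (k1 : k = (wt true * r1)%N) (k2 : k = (wt false * r2)%N).

Local Notation spr := (spread n om wt k (@param_nullhtpy R y y1 y2 d d1 d2)).

Lemma spr_weight (u : bool -> T -> R[i]) (l e : T -> R[i]) :
  (forall b, weight_fun (wt b) (u b)) -> weight_fun k l -> weight_fun 1 e ->
  forall b, weight_fun (wt b) (fun p => spr (u^~ p) (l p) (e p) b).
Proof.
move=> hu [l1 l2 l3] [e1 e2 e3] b; split.
- apply: spread_cont => //; first exact: param_nullhtpy_cont.
  by move=> b'; have [] := hu b'.
- move=> p; rewrite l2 e2 expr1.
  have hrot u0 l0 b0 := param_nullhtpy_rot yE1 yE2 dE1 dE2 u0 l0 b0 om_unit k1 k2.
  rewrite -(spread_rot om_prim om_unit hrot).
  by congr (spr _ _ _ _); apply/funext => b'; have [_ ->] := hu b'.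
- move=> p; rewrite l3 e3.
  rewrite -(spread_conj om_prim om_unit wt k (@param_nullhtpy_conj R y y1 y2 d d1 d2)).
  by congr (spr _ _ _ _); apply/funext => b'; have [_ _ ->] := hu b'.
Qed.

Lemma spr_eq0 u l e : l != 0 -> (forall b, spr u l e b = 0) ->
  (forall b, u b = 0) /\ forall c, (c < n)%N ->
    arc_bump n om (conjc om ^+ c * e) * slit_bump (conjc om ^+ (c * k) * l) = 0.
Proof.
have hrot u0 l0 b0 := param_nullhtpy_rot yE1 yE2 dE1 dE2 u0 l0 b0 om_unit k1 k2.
apply: (spread_eq0 n_odd om_prim om_unit hrot) => u0 l0 s0.
exact: (param_nullhtpy_eq0 yE2 y_even d_odd).
Qed.

(** The four copies cover all directions of e and of the parameter l: for a
given nonzero e a rotated copy of the bump is positive at e or at -e, and for a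
given nonzero l the slit bump is positive at l or at -l.  Each copy keeps
nonzero vectors nonzero. *)
Definition spread4 u l e :=
  spr (spr (spr (spr u l e) (- l) e) l (- e)) (- l) (- e).

Lemma spread4_weight (u : bool -> T -> R[i]) (l e : T -> R[i]) :
  (forall b, weight_fun (wt b) (u b)) -> weight_fun k l -> weight_fun 1 e ->
  forall b, weight_fun (wt b) (fun p => spread4 (u^~ p) (l p) (e p) b).
Proof.
move=> hu hl he.
have hl' := weight_funN hl; have he' := weight_funN he.
have h1 := spr_weight hu hl he.
have h2 := spr_weight h1 hl' he.
have h3 := spr_weight h2 hl he'.
exact: spr_weight h3 hl' he'.
Qed.

Lemma slit_bump_cover l : slit_bump l = 0 -> slit_bump (- l) = 0 -> l = 0 :> R[i].
Proof.
move=> /eqP; rewrite pospart_eq0 => h1 /eqP; rewrite pospart_eq0 !raddfN /= normrN => h2.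
have := normr_ge0 (Im l) => h3.
have /eqP : `|Im l| = 0 by lra.
rewrite normr_eq0 => /eqP i0; have r0 : Re l = 0 by move: h1 h2; rewrite i0 normr0; lra.
by apply/eqP; rewrite eq_complex r0 i0 eqxx.
Qed.

Lemma spread4_eq0 u l e : l != 0 -> (forall b, spread4 u l e b = 0) ->
  (forall b, u b = 0) /\ e = 0.
Proof.
move=> l0 h; have l0' : - l != 0 by rewrite oppr_eq0.
have [{}h h4] := spr_eq0 l0' h; have [{}h h3] := spr_eq0 l0 h.
have [{}h h2] := spr_eq0 l0' h; have [{}h h1] := spr_eq0 l0 h.
split=> //.
have nul0 c : conjc om ^+ (c * k) * l != 0.
  by rewrite mulf_neq0 // expf_neq0 // conjc_eq0 (unit_root_neq0 om_unit).
apply: (arc_bump_cover n_odd om_prim om_unit) => c cn.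
  move: (h1 c cn) (h2 c cn); rewrite mulrN => /eqP; rewrite mulf_eq0.
  case/orP=> [/eqP//|/eqP t1] /eqP; rewrite mulf_eq0 => /orP[/eqP//|/eqP t2].
  by have := slit_bump_cover t1 t2 => /eqP; rewrite (negbTE (nul0 c)).
move: (h3 c cn) (h4 c cn); rewrite !mulrN => /eqP; rewrite mulf_eq0.
case/orP=> [/eqP//|/eqP t1] /eqP; rewrite mulf_eq0 => /orP[/eqP//|/eqP t2].
by have := slit_bump_cover t1 t2 => /eqP; rewrite (negbTE (nul0 c)).
Qed.

End Data.

(** Bezout relations for the coprime pair r1, 2 r2: using the even number 2 r2
makes the first product even and the second one odd. *)
Lemma parity_bezout r1 r2 : (0 < r1)%N -> (0 < r2)%N -> coprime r1 r2 -> odd r1 ->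
  exists y1 y2 d1 d2, [/\ (r2 * y1 = (r1 * y2).+1)%N, (r1 * d1 = (r2 * d2).+1)%N,
     ~~ odd (r2 * y1) & odd (r1 * d1)].
Proof.
move=> r1_gt0 r2_gt0 r12 r1o.
have co : coprime r1 (2 * r2) by rewrite coprimeMr r12 coprimen2 r1o.
have /(coprimeP _ r1_gt0)[[u v] /= uv] := co.
have /(coprimeP _ (_ : 0 < 2 * r2)%N)[|[u' v'] /= uv'] : coprime (2 * r2) r1 by rewrite coprime_sym.
  by rewrite muln_gt0.
exists (2 * u')%N, v', u, (2 * v)%N; split.
- by lia.
- by lia.
- by rewrite mulnCA oddM.
- have -> : (r1 * u = (2 * (r2 * v)).+1)%N by lia.
  by rewrite /= oddM.
Qed.

(** The functions a and b start as 0, and each e i is fed in turn to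
[spread4]; a value that is once nonzero stays nonzero. *)
Lemma split_weight (k1 k2 N : nat) (l : T -> R[i]) (e : 'I_N -> T -> R[i]) :
  odd k1 -> odd k2 -> weight_fun (lcmn k1 k2) l -> (forall i, weight_fun 1 (e i)) ->
  exists a b : T -> R[i], [/\ weight_fun k1 a, weight_fun k2 b &
    forall p, l p != 0 -> (exists i, e i p != 0) -> (a p != 0) || (b p != 0)].
Proof.
move=> k1o k2o hl he.
have k1_gt0 : (0 < k1)%N by case: k1 k1o {hl}.
have k2_gt0 : (0 < k2)%N by case: k2 k2o {hl}.
have g_gt0 : (0 < gcdn k1 k2)%N by rewrite gcdn_gt0 k1_gt0.
pose r1 := (k2 %/ gcdn k1 k2)%N; pose r2 := (k1 %/ gcdn k1 k2)%N.
have k1E : k1 = (r2 * gcdn k1 k2)%N by rewrite divnK // dvdn_gcdl.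
have k2E : k2 = (r1 * gcdn k1 k2)%N by rewrite divnK // dvdn_gcdr.
have r1_gt0 : (0 < r1)%N by rewrite divn_gt0 // dvdn_leq // dvdn_gcdr.
have r2_gt0 : (0 < r2)%N by rewrite divn_gt0 // dvdn_leq // dvdn_gcdl.
have r1o : odd r1 by move: k2o; rewrite k2E oddM => /andP[].
have co : coprime r1 r2.
  rewrite /coprime -(eqn_pmul2r g_gt0) muln_gcdl -k1E -k2E mul1n gcdnC //.
have [y1 [y2 [d1 [d2 [yE dE y_even d_odd]]]]] := parity_bezout r1_gt0 r2_gt0 co r1o.
pose wt b := if b then k1 else k2.
have lE1 : lcmn k1 k2 = (wt true * r1)%N by rewrite /lcmn /wt muln_divA // dvdn_gcdr.
have lE2 : lcmn k1 k2 = (wt false * r2)%N by rewrite /lcmn /wt mulnC muln_divA // dvdn_gcdl.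
suff [a ha an] : exists2 a : bool -> T -> R[i], (forall b, weight_fun (wt b) (a b)) &
    forall p, l p != 0 -> (exists i, e i p != 0) -> ~ (forall b, a b p = 0).
  exists (a true), (a false); split; [exact: (ha true)|exact: (ha false)|].
  move=> p lp ep; rewrite -negb_and; apply/negP => /andP[/eqP h1 /eqP h2].
  by apply: (an p lp ep); case.
elim: N e he => [|N IH] e he.
  exists (fun _ _ => 0); first by move=> b; exact: weight_fun0.
  by move=> p _ [[]].
have [a ha an] := IH (fun i => e (lift ord0 i)) (fun i => he (lift ord0 i)).
exists (fun b p => spread4 (r2 * y1) y1 y2 (r1 * d1) d1 d2 wt (lcmn k1 k2)
  (a^~ p) (l p) (e ord0 p) b).
  by move=> b; apply: (spread4_weight (r1 := r1) (r2 := r2)).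
move=> p lp [i ei] h.
have [a0 e0] := spread4_eq0 (r1 := r1) (r2 := r2) erefl yE erefl dE y_even d_odd lE1 lE2 lp h.
case: (unliftP ord0 i) ei => [j ->|->] ej; last by rewrite e0 eqxx in ej.
by apply: (an p lp) a0; exists j.
Qed.

Lemma odd_biglcm (s : seq nat) : all odd s -> odd (\big[lcmn/1%N]_(j <- s) j).
Proof.
elim: s => [|j s IH] /=; first by rewrite big_nil.
move=> /andP[jo /IH]; rewrite big_cons; set m := \big[_/_]_(_ <- _) _ => mo.
have : odd (lcmn j m * gcdn j m) by rewrite muln_lcm_gcd oddM jo.
by rewrite oddM => /andP[].
Qed.

(** Splits off one weight of the list at a time. *)
Lemma split_weights (ks : seq nat) (N : nat) (l : T -> R[i]) (e : 'I_N -> T -> R[i]) :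
  ks != [::] -> uniq ks -> all odd ks ->
  weight_fun (\big[lcmn/1%N]_(k <- ks) k) l -> (forall i, weight_fun 1 (e i)) ->
  exists2 f : nat -> T -> R[i], (forall k, k \in ks -> weight_fun k (f k)) &
    forall p, l p != 0 -> (exists i, e i p != 0) -> has (fun k => f k p != 0) ks.
Proof.
case: ks => // k ks _; elim: ks k l => [|k' ks IH] k l.
  move=> _ _; rewrite big_seq1 => hl he; exists (fun _ => l) => [j|p lp _ /=].
    by rewrite inE => /eqP ->.
  by rewrite lp.
move=> /andP[kn un] /andP[ko kso]; rewrite big_cons => hl he.
have lo : odd (\big[lcmn/1%N]_(j <- k' :: ks) j).
  exact: odd_biglcm.
have [a [b [ha hb ab]]] := split_weight ko lo hl he.
have [f hf fn] := IH k' b un kso hb he.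
exists (fun j => if j == k then a else f j) => [j|p lp ep].
  by rewrite inE; case: eqVneq => [-> _ //|_ /= jk]; exact: hf.
apply/hasP; have /orP[ap|bp] := ab p lp ep.
  by exists k; rewrite ?mem_head // eqxx.
have /hasP[j jk fj] := fn p bp ep.
exists j; first by rewrite inE jk orbT.
case: (eqVneq j k) => // jkE.
by move: kn; rewrite -jkE jk.
Qed.

End Split.

(** * The dihedral group *)

Section DihedralGroup.
Variables (gT : finGroupType) (n : nat) (G : {group gT}) (x y : gT).
Hypotheses (n_gt1 : (1 < n)%N) (dih : dihedral_presentation n G x y).
Local Open Scope group_scope.

(** The relations alone bound the order of G from above by 2 n; the
presentation gives a morphism onto the dihedral group of order 2 n, which
bounds it from below. *)
Lemma dihedral_card_ge : (n.*2 <= #|G|)%N.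
Proof.
have [iso _ _ _ _] := dih.
suff : 'D_(n.*2) \homg G.
  by move/card_homg; rewrite card_dihedral // => /dvdn_leq; apply; exact: cardG_gt0.
rewrite iso; have : 'D_(n.*2) \homg 'D_(n.*2) by exact: homg_refl.
rewrite (Grp_dihedral n_gt1) => /existsP[[a b]] /=; rewrite !xpair_eqE.
case/and4P=> ab /eqP an /eqP b2 /eqP abJ.
apply/existsP; exists (a, b); rewrite /= !xpair_eqE ab an b2 !eqxx /=.
have bV : b^-1 = b by apply/eqP; rewrite eq_invg_mul -expg2 b2.
by rewrite -abJ conjgE bV -!mulgA -expg2 b2 mulg1.
Qed.

Lemma dihedral_decomp :
  [/\ G :=: <[x]> * <[y]>, #[x] = n, #[y] = 2%N, <[x]> :&: <[y]> = 1 &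
      x \in G /\ y \in G].
Proof.
have [_ gen xn y2 yx] := dih.
have yV : y^-1 = y by apply/eqP; rewrite eq_invg_mul -expg2 y2.
have ny : y \in 'N(<[x]>).
  have xyE : x ^ y = x^-1 by rewrite conjgE yV mulgA yx -mulgA -expg2 y2 mulg1.
  by rewrite !inE -cycleJ xyE cycleV.
have GE : G :=: <[x]> * <[y]>.
  rewrite -gen -norm_joinEr ?cycle_subG //.
  by rewrite joing_idl joing_idr.
have ox : (#[x] <= n)%N by rewrite dvdn_leq ?order_dvdn ?xn // (ltn_trans _ n_gt1).
have oy : (#[y] <= 2)%N by rewrite dvdn_leq ?order_dvdn ?y2.
have := mul_cardG <[x]> <[y]>; rewrite -GE -!orderE => E.
have := dihedral_card_ge.
have oxy : (#[x] * #[y] <= n.*2)%N by rewrite -muln2 leq_mul.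
have I_gt0 : (0 < #|(<[x]> :&: <[y]>)%G|)%N by exact: cardG_gt0.
move=> ge; have G_gt0 := cardG_gt0 G.
have I1 : #|<[x]> :&: <[y]>| = 1%N.
  move: E I_gt0 ge oxy G_gt0; rewrite /=.
  move: (#[x] * #[y])%N #|G| #|<[x]> :&: <[y]>| => a b c; clear; nia.
have {E}: (#[x] * #[y] = n.*2)%N.
  by apply/eqP; rewrite eqn_leq oxy E I1 muln1.
have := order_gt0 x; have := order_gt0 y; move: ox oy n_gt1.
move: I1 => I1 ox oy n1 y0 x0 E.
have {}oy : #[y] = 2%N.
  apply/eqP; rewrite eqn_leq oy /= ltnNge; apply/negP => oy1.
  by move: E ox oy1 y0 n1; move: #[x] #[y]; clear; nia.
split=> //.
- by move: E; rewrite oy -muln2 => /eqP; rewrite eqn_pmul2r // => /eqP.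
- exact: card1_trivg I1.
- by rewrite -gen !mem_gen ?set21 ?set22.
Qed.

Lemma dihedral_elts g : g \in G -> exists i b, g = x ^+ i * y ^+ b.
Proof.
have [-> _ _ _ _] := dihedral_decomp.
by case/mulsgP=> _ _ /cycleP[i ->] /cycleP[b ->] ->; exists i, b.
Qed.

Lemma dihedral_uniq i j b c : x ^+ i * y ^+ b = x ^+ j * y ^+ c ->
  (i = j %[mod n])%N /\ (b = c %[mod 2])%N.
Proof.
have [_ ox oy tI _] := dihedral_decomp.
move=> E.
have E' : x ^- j * x ^+ i = y ^+ c * y ^- b.
  by apply: (mulgI (x ^+ j)); rewrite mulKVg mulgA -E mulgK.
have : x ^- j * x ^+ i \in <[x]> :&: <[y]>.
  rewrite inE {2}E' !groupM ?groupV ?mem_cycle //.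
rewrite tI => /set1P e1.
split; apply/eqP.
  by rewrite -ox -eq_expg_mod_order eq_sym eq_mulVg1 e1.
rewrite -oy -eq_expg_mod_order eq_mulgV1 -eq_invg1 invMg invgK.
by rewrite -E' e1.
Qed.
Lemma dihedral_yX j : y * x ^+ j = x ^+ (n.-1 * j) * y.
Proof.
have [_ _ xn _ yx] := dih.
have xV : x^-1 = x ^+ n.-1.
  by apply/eqP; rewrite eq_invg_mul -expgS prednK ?(ltnW n_gt1) // xn.
elim: j => [|j IH]; first by rewrite muln0 mulg1 mul1g.
by rewrite expgSr mulgA IH -mulgA yx xV mulgA -expgD mulnS addnC.
Qed.

End DihedralGroup.

(** * Representations of the dihedral group *)

Section DihedralRepr.
Variables (F : fieldType) (m n : nat) (X Y : 'M[F]_m).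
Variables (gT : finGroupType) (G : {group gT}) (x y : gT).
Hypotheses (n_gt1 : (1 < n)%N) (dih : dihedral_presentation n G x y).
Hypotheses (Xn : X ^+ n = 1) (Y2 : Y ^+ 2 = 1) (YX : Y * X = X ^+ n.-1 * Y).

(** X and Y need not lie in a finite group of matrices, so the universal property
of the presentation, which speaks of finite groups, gives no morphism; normal
forms of group elements are used instead. *)
Definition dihedral_mx (g : gT) : 'M[F]_m :=
  if [pick p : 'I_n * 'I_2 | (x ^+ p.1 * y ^+ p.2)%g == g] is Some p
  then X ^+ p.1 * Y ^+ p.2 else 1.

Lemma dihedral_mxE i b : dihedral_mx (x ^+ i * y ^+ b)%g = X ^+ i * Y ^+ b.
Proof.
have n_gt0 : (0 < n)%N by exact: ltnW.
have [_ _ xn y2 _] := dih.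
have Xmod k : X ^+ (k %% n) = X ^+ k.
  by rewrite [in RHS](divn_eq k n) exprD mulnC exprM Xn expr1n mul1r.
have Ymod k : Y ^+ (k %% 2) = Y ^+ k.
  by rewrite [in RHS](divn_eq k 2) exprD mulnC exprM Y2 expr1n mul1r.
rewrite /dihedral_mx; case: pickP => [[j c] /= /eqP /(dihedral_uniq n_gt1 dih)[ij bc]|].
  by rewrite -(Xmod i) -(Ymod b) -ij -bc Xmod Ymod.
have im : (i %% n < n)%N by rewrite ltn_mod.
have bm : (b %% 2 < 2)%N by rewrite ltn_mod.
move=> /(_ (Ordinal im, Ordinal bm)) /=.
by rewrite !expg_mod // eqxx.
Qed.

Lemma dihedral_YX j : Y * X ^+ j = X ^+ (n.-1 * j) * Y.
Proof.
elim: j => [|j IH]; first by rewrite muln0 mulr1 mul1r.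
by rewrite exprSr mulrA IH -mulrA YX mulrA -exprD mulnS addnC.
Qed.

Lemma dihedral_mx_repr : mx_repr G dihedral_mx.
Proof.
split; first by have := dihedral_mxE 0 0; rewrite !expg0 mulg1 !expr0 mulr1.
move=> _ _ /(dihedral_elts n_gt1 dih)[i [b ->]] /(dihedral_elts n_gt1 dih)[j [c ->]].
have [k [kE KE]] : exists k, (y ^+ b * x ^+ j = x ^+ k * y ^+ b)%g /\
    Y ^+ b * X ^+ j = X ^+ k * Y ^+ b.
  elim: b => [|b [k [e1 e2]]]; first by exists j; rewrite !mul1g !mulg1 !mul1r !mulr1.
  exists (n.-1 * k)%N; split.
    by rewrite expgS -mulgA e1 mulgA (dihedral_yX n_gt1 dih) -mulgA.
  by rewrite exprS -mulrA e2 mulrA dihedral_YX -mulrA.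
have -> : (x ^+ i * y ^+ b * (x ^+ j * y ^+ c) = x ^+ (i + k) * y ^+ (b + c))%g.
  by rewrite -mulgA (mulgA (y ^+ b)%g) kE -mulgA -expgD mulgA -expgD.
rewrite !dihedral_mxE -[RHS]/(_ * _).
by rewrite -mulrA (mulrA (Y ^+ b)) KE -mulrA -exprD mulrA -exprD.
Qed.

Definition dihedral_repr := MxRepresentation dihedral_mx_repr.

Lemma dihedral_repr_x : dihedral_repr x = X.
Proof. by have := dihedral_mxE 1 0; rewrite expg0 expg1 mulg1 expr0 expr1 mulr1. Qed.

Lemma dihedral_repr_y : dihedral_repr y = Y.
Proof. by have := dihedral_mxE 0 1; rewrite expg0 expg1 mul1g expr0 expr1 mul1r. Qed.

End DihedralRepr.

(** * The representation N V_1 *)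

Section RootsOfUnity.
Variable R : realType.

Lemma exists_unit_prim_root n : (0 < n)%N ->
  exists2 om : R[i], n.-primitive_root om & om * conjc om = 1.
Proof.
move=> n_gt0.
have [rs rsE] := closed_field_poly_normal ('X^n - 1 : {poly R[i]}).
rewrite (monicP _) ?monicXnsubC // scale1r in rsE.
have rs_uniq : uniq rs.
  by rewrite -separable_prod_XsubC -rsE separable_Xn_sub_1 // pnatr_eq0 -lt0n.
have rs_size : size rs = n.
  apply/eqP; rewrite -eqSS -(size_prod_XsubC rs id) -rsE.
  by rewrite size_XnsubC.
have /hasP[om _ om_prim] : has n.-primitive_root rs.
  apply: has_prim_root; rewrite ?rs_size //.
  apply/allP => z z_rs; have : root ('X^n - 1) z by rewrite rsE root_prod_XsubC.
  by rewrite rootE !hornerE => zn; rewrite unity_rootE -subr_eq0.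
exists om => //; rewrite -sqmodE.
have : sqmod om ^+ n = 1.
  apply: complexI; rewrite rmorphXn /= sqmodE exprMn -rmorphXn.
  by rewrite (prim_expr_order om_prim) rmorph1 mulr1.
by move/eqP; rewrite pexpr_eq1 ?sqmod_ge0 // => /eqP ->.
Qed.

End RootsOfUnity.

(** The first N coordinates of a row are the real parts and the last N
coordinates the imaginary parts of a vector of C^N. *)
Section PlaneSum.
Variables (R : realType) (N n : nat) (om : R[i]).
Hypotheses (n_gt1 : (1 < n)%N) (om_prim : n.-primitive_root om).
Hypothesis om_unit : om * conjc om = 1.
Local Notation c := (Re om).
Local Notation s := (Im om).

Definition plane_coord (i : 'I_N) (p : 'rV[R]_(N + N)) : R[i] :=
  Complex (p ord0 (lshift N i)) (p ord0 (rshift N i)).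

Definition plane_rot : 'M[R]_(N + N) := block_mx c%:M s%:M (- s)%:M c%:M.
Definition plane_flip : 'M[R]_(N + N) := block_mx 1%:M 0 0 (- 1)%:M.

Lemma plane_coord_rot i p : plane_coord i (p *m plane_rot) = om * plane_coord i p.
Proof.
rewrite -[p]hsubmxK /plane_rot mul_row_block /plane_coord !(row_mxEl, row_mxEr).
rewrite !mul_mx_scalar !mxE; case: om => a b /=; simpc.
by congr (_ +i* _); ring.
Qed.

Lemma plane_coord_flip i p : plane_coord i (p *m plane_flip) = conjc (plane_coord i p).
Proof.
rewrite -[p]hsubmxK /plane_flip mul_row_block /plane_coord !(row_mxEl, row_mxEr).
rewrite !mul_mx_scalar !mulmx0 !mxE /=.
by congr (_ +i* _); ring.
Qed.

Lemma plane_coord_inj p q : (forall i, plane_coord i p = plane_coord i q) -> p = q.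
Proof.
move=> h; apply/rowP => j.
by case: (split_ordP j) => i ->; have [] := h i.
Qed.

Lemma plane_mx_ext (A B : 'M[R]_(N + N)) :
  (forall i p, plane_coord i (p *m A) = plane_coord i (p *m B)) -> A = B.
Proof.
move=> h; apply/row_matrixP => k; rewrite !rowE.
by apply: plane_coord_inj => i.
Qed.

Lemma plane_coord_rotX k i p :
  plane_coord i (p *m plane_rot ^+ k) = om ^+ k * plane_coord i p.
Proof.
elim: k p => [|k IH] p; first by rewrite expr0 mulmx1 mul1r.
by rewrite exprS mulmxA IH plane_coord_rot mulrA exprSr.
Qed.

Lemma plane_rotX : plane_rot ^+ n = 1.
Proof.
apply: plane_mx_ext => i p.
by rewrite plane_coord_rotX (prim_expr_order om_prim) mul1r mulmx1.
Qed.

Lemma plane_flip2 : plane_flip ^+ 2 = 1.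
Proof.
apply: plane_mx_ext => i p; rewrite expr2 mulmxA !plane_coord_flip conjcK.
by rewrite mulmx1.
Qed.

Lemma plane_flip_rot : plane_flip * plane_rot = plane_rot ^+ n.-1 * plane_flip.
Proof.
apply: plane_mx_ext => i p; rewrite !mulmxA plane_coord_rot !plane_coord_flip.
rewrite plane_coord_rotX rmorphM rmorphXn /=; congr (_ * _).
rewrite (conjc_rootX om_prim om_unit) ?leq_pred //.
by rewrite (_ : n - n.-1 = 1)%N ?expr1 //; lia.
Qed.

Lemma plane_rot_orth : plane_rot *m plane_rot^T = 1%:M.
Proof.
have tr i p : plane_coord i (p *m plane_rot^T) = conjc om * plane_coord i p.
  rewrite /plane_rot tr_block_mx !tr_scalar_mx -[p]hsubmxK mul_row_block.
  rewrite /plane_coord !(row_mxEl, row_mxEr) !mul_mx_scalar !mxE.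
  by case: om => a b /=; simpc; congr (_ +i* _); ring.
apply: plane_mx_ext => i p; rewrite mulmxA tr plane_coord_rot mulmx1.
by rewrite mulrA [_ * om]mulrC om_unit mul1r.
Qed.

Lemma plane_flip_orth : plane_flip *m plane_flip^T = 1%:M.
Proof.
have -> : plane_flip^T = plane_flip by rewrite tr_block_mx !tr_scalar_mx !trmx0.
exact: plane_flip2.
Qed.

Lemma plane_coord_cont i : ccont (plane_coord i).
Proof. by split; exact: coord_continuous. Qed.

Lemma plane_coord_neq0 p : p != 0 -> exists i, plane_coord i p != 0.
Proof.
move=> p0; apply/existsP; apply: contraNT p0; rewrite negb_exists => /forallP h.
apply/eqP/plane_coord_inj => i; have := h i; rewrite negbK => /eqP ->.
by rewrite /plane_coord !mxE.
Qed.

End PlaneSum.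

(** * The planes contained in V *)

Section NoSign.
Variables (R : realType) (gT : finGroupType) (G : {group gT}).

(** By Maschke, the line spanned by v has an invariant complement. *)
Lemma line_summand (sigma : mx_representation R G 1) (d : nat)
    (rV : mx_representation R G d) (v : 'rV[R]_d) : v != 0 ->
  (forall g, g \in G -> v *m rV g = sigma g *m v) -> has_summand rV sigma.
Proof.
move=> v0 vG; pose U := <<v>>%MS.
have modU : mxmodule rV U.
  by apply/mxmoduleP => g Gg; rewrite (eqmxMr _ (genmxE v)) genmxE vG // submxMl.
have R0 : (([pchar R]^').-group G)%g.
  by apply/pgroupP => p _ _; rewrite inE /= pchar_num.
have [W modW UW dUW] := mx_Maschke_pchar rV R0 modU (submx1 U).
pose rW := Representation (submod_repr modW).
exists rW; have mod1 := mxmodule1 rV.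
apply: mx_rsim_trans (mx_rsim_sym (rsim_submod1 mod1 (eqmx_refl _))) _.
apply: (mx_rsim_dadd (modU := modU) (modV := modW) mod1 UW dUW); last exact: mx_rsim_refl.
apply: mx_rsim_sym; have vU : (v <= U)%MS by rewrite genmxE.
exists (in_submod U v).
- by rewrite /= genmxE rank_rV v0.
- rewrite /row_free rank_rV; suff -> : in_submod U v != 0 by [].
  by apply: contraNneq v0 => h; rewrite -(in_submodK vU) h linear0.
by move=> g Gg /=; rewrite -(in_submodJ modU _ vU) vG // in_submodE mulmxA -in_submodE.
Qed.

End NoSign.

Section Eigen.
Variables (R : realType) (n d : nat) (om : R[i]).
Hypotheses (n_gt1 : (1 < n)%N) (om_prim : n.-primitive_root om).
Hypothesis om_unit : om * conjc om = 1.
Local Notation nu := (conjc om).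
Local Notation toC := (map_mx (real_complex R)).
Variable X : 'M[R[i]]_d.
Hypothesis Xn : X ^+ n = 1.
Implicit Types (v w : 'rV[R[i]]_d).

(** n times the projection to the eigenspace of X for the eigenvalue om^j. *)
Definition eigenproj (j : nat) v : 'rV[R[i]]_d :=
  \sum_(l < n) nu ^+ (j * l) *: (v *m X ^+ l).

Lemma eigenproj_eigen j v : eigenproj j v *m X = om ^+ j *: eigenproj j v.
Proof.
rewrite /eigenproj mulmx_suml scaler_sumr.
rewrite -[RHS](@sum_shift _ n (fun l => om ^+ j *: (nu ^+ (j * l) *: (v *m X ^+ l)))).
  apply: eq_bigr => l _; rewrite -scalemxAl -mulmxA exprSr scalerA; congr (_ *: _).
  by rewrite mulnS exprD mulrA (root_mul_conjX om_unit) mul1r.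
by rewrite muln0 Xn mulnC exprM (conjc_rootX om_prim om_unit) // subnn !expr0 expr1n.
Qed.

Lemma sum_unity (z : R[i]) : z ^+ n = 1 -> z != 1 -> \sum_(l < n) z ^+ l = 0.
Proof.
move=> zn z1; apply/eqP; have := subrX1 z n; rewrite zn subrr => /esym/eqP.
by rewrite mulf_eq0 subr_eq0 (negbTE z1).
Qed.

Lemma eigenX i v l : v *m X = om ^+ i *: v -> v *m X ^+ l = om ^+ (i * l) *: v.
Proof.
move=> vX; elim: l => [|l IH]; first by rewrite muln0 expr0 mulmx1 scale1r.
by rewrite exprS mulmxA vX -scalemxAl IH scalerA -exprD mulnS.
Qed.

Lemma eigenproj_on i j v : (i < n)%N -> (j < n)%N -> v *m X = om ^+ i *: v ->
  eigenproj j v = (if i == j then n%:R else 0) *: v.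
Proof.
move=> lti ltj vX.
have -> : eigenproj j v = (\sum_(l < n) (nu ^+ j * om ^+ i) ^+ l) *: v.
  rewrite /eigenproj scaler_suml; apply: eq_bigr => l _.
  by rewrite (eigenX _ vX) scalerA exprMn -!exprM.
congr (_ *: _); case: eqVneq => [->|ij].
  under eq_bigr do rewrite mulrC (root_mul_conjX om_unit) expr1n.
  by rewrite sumr_const card_ord.
apply: sum_unity.
  by rewrite exprMn -!exprM ![(_ * n)%N]mulnC !exprM (prim_expr_order om_prim)
     (conjc_rootX om_prim om_unit) // subnn !expr0 !expr1n mulr1.
rewrite (conjc_rootX om_prim om_unit (ltnW ltj)) -exprD -(prim_order_dvd om_prim).
apply/negP => /dvdnP[k kE].
have : k = 1%N by nia.
by move=> k1; move/eqP: ij; lia.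
Qed.

Lemma eigenproj_sum v : \sum_(j < n) eigenproj j v = n%:R *: v.
Proof.
rewrite exchange_big /= (bigD1 (Ordinal (ltnW n_gt1))) //= [X in _ + X]big1 ?addr0.
  under eq_bigr do rewrite /= muln0 !expr0 scale1r mulmx1.
  by rewrite sumr_const card_ord scaler_nat.
move=> l l0; rewrite -scaler_suml.
under eq_bigr do rewrite mulnC exprM.
rewrite sum_unity ?scale0r //.
  by rewrite -exprM mulnC exprM (conjc_rootX om_prim om_unit) // subnn expr0 expr1n.
have l_gt0 : (0 < l)%N by rewrite lt0n; apply: contraNneq l0 => h; apply/eqP/val_inj.
rewrite (conjc_rootX om_prim om_unit (ltnW (ltn_ord l))) -(prim_order_dvd om_prim).
apply/negP => /dvdn_leq; have := ltn_ord l; lia.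
Qed.

Lemma eigenprojD j v w : eigenproj j (v + w) = eigenproj j v + eigenproj j w.
Proof.
rewrite /eigenproj -big_split; apply: eq_bigr => l _ /=.
by rewrite mulmxDl scalerDr.
Qed.

Lemma eigenprojZ j (a : R[i]) v : eigenproj j (a *: v) = a *: eigenproj j v.
Proof.
rewrite /eigenproj scaler_sumr; apply: eq_bigr => l _ /=.
by rewrite -scalemxAl !scalerA mulrC.
Qed.

Lemma eigenproj_bigsum j (I : Type) (r : seq I) (F : I -> 'rV[R[i]]_d) :
  eigenproj j (\sum_(i <- r) F i) = \sum_(i <- r) eigenproj j (F i).
Proof.
elim: r => [|i r IH]; last by rewrite !big_cons eigenprojD IH.
by rewrite !big_nil; have := eigenprojZ j 0 0; rewrite !scale0r.
Qed.

End Eigen.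

Section RealEigen.
Variables (R : realType) (gT : finGroupType) (n d : nat) (G : {group gT}) (x y : gT).
Variables (om : R[i]) (rV : mx_representation R G d).
Hypotheses (n_gt1 : (1 < n)%N) (n_odd : odd n) (om_prim : n.-primitive_root om).
Hypothesis om_unit : om * conjc om = 1.
Hypothesis dih : dihedral_presentation n G x y.
Local Notation nu := (conjc om).
Local Notation toC := (map_mx (real_complex R)).
Local Notation conjM := (map_mx (@conjc R)).
Local Notation X := (toC (rV x)).
Local Notation Y := (toC (rV y)).

(** For such a w, the map z |-> Re(z w) from V_j to V is equivariant. *)
Definition weight_vector (j : nat) (w : 'rV[R[i]]_d) :=
  [/\ w != 0, w *m X = om ^+ j *: w & w *m Y = conjM w].

Let xG : x \in G. Proof. by have [_ _ _ _ []] := dihedral_decomp n_gt1 dih. Qed.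
Let yG : y \in G. Proof. by have [_ _ _ _ []] := dihedral_decomp n_gt1 dih. Qed.

Lemma map_complexX (A : 'M[R]_d) k : toC A ^+ k = toC (A ^+ k).
Proof.
elim: k => [|k IH]; first by rewrite !expr0 map_mx1.
by rewrite !exprS IH; exact/esym/map_mxM.
Qed.

Lemma repr_expr g k : g \in G -> rV (g ^+ k)%g = rV g ^+ k.
Proof.
move=> gG; elim: k => [|k IH]; first by rewrite repr_mx1.
by rewrite expgS repr_mxM ?groupX // IH exprS.
Qed.

Lemma repr_rotX : X ^+ n = 1.
Proof.
by have [_ _ xn _ _] := dih; rewrite map_complexX -repr_expr // xn repr_mx1 map_mx1.
Qed.

Lemma repr_flip2 : Y *m Y = 1%:M.
Proof.
have [_ _ _ y2 _] := dih.
by rewrite -map_mxM -repr_mxM // -expg2 y2 repr_mx1 map_mx1.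
Qed.

Lemma repr_rot_flip : X *m (Y *m X) = Y.
Proof.
have [_ _ _ _ yx] := dih.
by rewrite -!map_mxM -!repr_mxM ?groupM // yx mulgA mulgV mul1g.
Qed.

Lemma conj_map_complex (A : 'M[R]_d) : conjM (toC A) = toC A.
Proof. by rewrite -map_mx_comp; apply: eq_map_mx => a /=; rewrite oppr0. Qed.

Lemma map_conj_mulmx (w : 'rV[R[i]]_d) (A : 'M[R]_d) : conjM (w *m toC A) = conjM w *m toC A.
Proof. by rewrite map_mxM conj_map_complex. Qed.

Lemma map_conjZ (a : R[i]) (w : 'rV[R[i]]_d) : conjM (a *: w) = conjc a *: conjM w.
Proof. by apply/matrixP => i j; rewrite !mxE rmorphM. Qed.

Lemma map_conjK (w : 'rV[R[i]]_d) : conjM (conjM w) = w.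
Proof. by apply/matrixP => i j; rewrite !mxE conjcK. Qed.

(** The conjugate-linear involution w |-> conj(w) Y preserves the eigenspace;
so one of w + conj(w) Y and 'i w is a nonzero fixed vector. *)
Lemma weight_vector_of_eigen j (w : 'rV[R[i]]_d) : w != 0 -> w *m X = om ^+ j *: w ->
  exists w', weight_vector j w'.
Proof.
move=> w0 wX; pose w2 := conjM w *m Y.
have w2X : w2 *m X = om ^+ j *: w2.
  have w2X1 : om ^+ j *: (conjM w *m X) = conjM w.
    have -> : conjM w *m X = nu ^+ j *: conjM w by rewrite -map_conj_mulmx wX map_conjZ rmorphXn.
    by rewrite scalerA (root_mul_conjX om_unit) scale1r.
  by rewrite /w2 -{1}w2X1 -!scalemxAl -!mulmxA repr_rot_flip.
have w2Y : w2 *m Y = conjM w by rewrite /w2 -mulmxA repr_flip2 mulmx1.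
have w2J : conjM w2 = w *m Y by rewrite map_conj_mulmx map_conjK.
have [w20|] := eqVneq (w + w2) 0; last first.
  move=> h; exists (w + w2); split=> //.
    by rewrite mulmxDl wX w2X scalerDr.
  by rewrite mulmxDl w2Y map_mxD w2J addrC.
exists ('i *: w); split.
- by rewrite scaler_eq0 negb_or w0 andbT eq_complex /= negb_and oner_eq0 orbT.
- by rewrite -scalemxAl wX !scalerA mulrC.
have wE : conjM w = - (w *m Y).
  move/eqP: w20; rewrite addr_eq0 => /eqP wE.
  by rewrite [in RHS]wE mulNmx w2Y opprK.
rewrite -scalemxAl map_conjZ wE scalerN -scaleNr; congr (_ *: _).
by apply/eqP; rewrite eq_complex /= oppr0 opprK !eqxx.
Qed.

(** The vector v + v y is fixed by G, hence 0; so a nonzero v would span a copy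
of sigma. *)
Lemma fixed_by_rotation_eq0 (sigma : mx_representation R G 1) :
  sigma x = 1%:M -> sigma y = (-1)%:M -> fixed_point_free rV ->
  ~ has_summand rV sigma -> forall v : 'rV[R]_d, v *m rV x = v -> v = 0.
Proof.
move=> sx sy fpf nosig v vx; apply/eqP/negPn/negP => v0; apply: nosig.
have elts := dihedral_elts n_gt1 dih.
have vxX i : v *m rV (x ^+ i)%g = v.
  elim: i => [|i IH]; first by rewrite repr_mx1 mulmx1.
  by rewrite expgS repr_mxM ?groupX // mulmxA vx IH.
have vy : v *m rV y = - v.
  apply/eqP; rewrite -addr_eq0 -submx0 -fpf; apply/rfix_mxP => g /elts[i [b ->]].
  have yy : rV y *m rV y = 1%:M.
    by have [_ _ _ y2 _] := dih; rewrite -repr_mxM // -expg2 y2 repr_mx1.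
  have xy_x j : v *m rV y *m rV (x ^+ j)%g = v *m rV y.
    rewrite -mulmxA -repr_mxM ?groupX // (dihedral_yX n_gt1 dih).
    by rewrite repr_mxM ?groupX // mulmxA vxX.
  rewrite repr_mxM ?groupX // mulmxA mulmxDl xy_x vxX.
  elim: b => [|b IH]; first by rewrite repr_mx1 mulmx1.
  by rewrite expgSr repr_mxM ?groupX // mulmxA IH mulmxDl -mulmxA yy mulmx1 addrC.
apply: (line_summand v0) => g /elts[i [b ->]].
rewrite !repr_mxM ?groupX // mulmxA vxX.
have -> : sigma (x ^+ i)%g = 1%:M.
  elim: i => [|i IH]; first by rewrite repr_mx1.
  by rewrite expgS repr_mxM ?groupX // sx IH mulmx1.
rewrite mul1mx; elim: b => [|b IH]; first by rewrite !repr_mx1 mulmx1 mul1mx.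
rewrite expgSr !repr_mxM ?groupX // sy mulmxA IH -!mulmxA vy.
by rewrite mul_scalar_mx scaleN1r.
Qed.

(** Decompose a real vector v that is fixed by the subgroup of order p^a into
eigenvectors of x.  A nonzero component for om^j is fixed by x^(n / p^a), whence
p^a | j, and j is not 0, because that component is the sum of the x^l v, a real
vector fixed by x.  If j is even, conjugation replaces it by the odd n - j. *)
Lemma exists_weight (p : nat) :
  (forall v : 'rV[R]_d, v *m rV x = v -> v = 0) ->
  (forall C : {group gT}, C \subset <[x]>%g -> #|C| = (p ^ logn p n)%N ->
     rfix_mx rV C != 0) ->
  exists j, [/\ odd j, (j < n)%N, (p ^ logn p n %| j)%N & exists w, weight_vector j w].
Proof.
move=> nofix fixC; set a := (p ^ logn p n)%N.
have an : (a %| n)%N by exact: pfactor_dvdnn.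
have n_gt0 : (0 < n)%N by exact: ltnW.
have [_ ox _ _ _] := dihedral_decomp n_gt1 dih.
pose q := (n %/ a)%N; have nE : n = (a * q)%N by rewrite mulnC divnK.
have a_gt0 : (0 < a)%N by move: n_gt0; rewrite nE muln_gt0 => /andP[].
have q_gt0 : (0 < q)%N by move: n_gt0; rewrite nE muln_gt0 => /andP[].
have := fixC <[x ^+ q]>%G; rewrite /= cycleX => /(_ isT).
have -> : #|<[x ^+ q]>%g| = a.
  by rewrite -orderE orderXdiv ox nE ?mulnK // dvdn_mull.
move=> /(_ erefl) fix0.
have [v v0 vq] : exists2 v : 'rV[R]_d, v != 0 & v *m rV (x ^+ q)%g = v.
  have /rowV0Pn[v vf v0] := fix0; exists v => //.
  by move/rfix_mxP: vf; apply; exact: cycle_id.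
pose vC := toC v.
have vC0 : vC != 0 by rewrite map_mx_eq0.
have [j jv] : exists j : 'I_n, eigenproj n om X j vC != 0.
  apply/existsP; apply: contraNT vC0; rewrite negb_exists => /forallP h.
  have := eigenproj_sum n_gt1 om_prim om_unit X vC.
  rewrite big1 => [/esym/eqP|i _]; last by apply/eqP; have := h i; rewrite negbK.
  by rewrite scaler_eq0 pnatr_eq0 eqn0Ngt n_gt0.
set u := eigenproj n om X j vC in jv.
have uX : u *m X = om ^+ j *: u := eigenproj_eigen om_prim om_unit repr_rotX j vC.
have vCq : vC *m X ^+ q = vC by rewrite map_complexX -repr_expr // -map_mxM vq.
have uq : u *m X ^+ q = u.
  rewrite /u /eigenproj mulmx_suml; apply: eq_bigr => l _.
  rewrite -scalemxAl -mulmxA -[X ^+ l *m X ^+ q]/(X ^+ l * X ^+ q) -exprD addnC exprD.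
  by rewrite -[X ^+ q * _]/(X ^+ q *m _) mulmxA vCq.
have aj : (a %| j)%N.
  have := eigenX q uX; rewrite uq => /eqP.
  rewrite -subr_eq0 -{1}[u]scale1r -scalerBl scaler_eq0 (negbTE jv) orbF subr_eq0 eq_sym.
  by rewrite -(prim_order_dvd om_prim) [X in (X %| _)%N]nE dvdn_pmul2r.
have j_gt0 : (0 < j)%N.
  rewrite lt0n; apply: contraNneq jv => j0.
  pose s : 'rV[R]_d := \sum_(l < n) v *m rV x ^+ l.
  have sE : u = toC s.
    rewrite /u /eigenproj raddf_sum /=; apply: eq_bigr => l _.
    by rewrite j0 mul0n expr0 scale1r map_complexX -map_mxM.
  have : s *m rV x = s.
    apply: (@map_mx_inj _ _ (real_complex R)).
    by rewrite map_mxM -sE uX j0 expr0 scale1r.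
  by move/nofix => s0; rewrite sE s0 map_mx0.
have [jo|je] := boolP (odd j).
  by exists j; split=> //; exact: weight_vector_of_eigen jv uX.
exists (n - j)%N; split.
- by rewrite oddB 1?ltnW // n_odd (negbTE je).
- by rewrite ltn_subrL j_gt0.
- by rewrite dvdn_sub.
apply: (weight_vector_of_eigen (w := conjM u)).
  by rewrite map_mx_eq0.
by rewrite -map_conj_mulmx uX map_conjZ rmorphXn /= (conjc_rootX om_prim om_unit) // ltnW.
Qed.

(** The real part vanishes only if S + conj(S) = 0.  The vectors w j have odd
eigenvalue exponents j < n, and their conjugates have the even exponents
n - j; so all the terms belong to distinct eigenvalues. *)
Lemma Re_weights_neq0 (J : seq nat) (w : nat -> 'rV[R[i]]_d) (f : nat -> R[i]) :
  uniq J -> (forall j, j \in J -> [/\ odd j, (j < n)%N & weight_vector j (w j)]) ->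
  has (fun j => f j != 0) J ->
  map_mx (@complex.Re R) (\sum_(j <- J) f j *: w j) != 0.
Proof.
move=> uJ hJ /hasP[k kJ fk]; apply/eqP; set S := \sum_(j <- J) _ => S0.
have SJ : S + conjM S = 0.
  apply/matrixP => i j; have := congr1 (fun A : 'M_(_, _) => A i j) S0.
  by rewrite !mxE; case: (S i j) => a b /= ->; apply/eqP; rewrite eq_complex /= addr0 subrr !eqxx.
have [ko kn [wk0 wkX _]] := hJ k kJ.
have onJ (j : nat) : j \in J ->
    eigenproj n om X k (w j) = (if j == k then n%:R else 0) *: w j.
  by move=> /hJ[_ jn [_ wX _]]; exact: (eigenproj_on n_gt1 om_prim om_unit jn kn wX).
have onJc (j : nat) : j \in J -> eigenproj n om X k (conjM (w j)) = 0.
  move=> /hJ[jo jn [_ wX _]].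
  have j_gt0 : (0 < j)%N by case: (j) jo.
  have cX : conjM (w j) *m X = om ^+ (n - j) *: conjM (w j).
    by rewrite -map_conj_mulmx wX map_conjZ rmorphXn /= (conjc_rootX om_prim om_unit) // ltnW.
  have njn : (n - j < n)%N by rewrite ltn_subrL j_gt0 (ltnW n_gt1).
  rewrite (eigenproj_on n_gt1 om_prim om_unit njn kn cX).
  case: eqP => [E|_]; last by rewrite scale0r.
  by move: ko; rewrite -E oddB 1?ltnW // n_odd jo.
have := congr1 (eigenproj n om X k) SJ.
have -> : eigenproj n om X k 0 = 0.
  by have := eigenprojZ n om X k 0 0; rewrite !scale0r.
have cS : conjM S = \sum_(j <- J) conjc (f j) *: conjM (w j).
  by rewrite raddf_sum; apply: eq_bigr => j _; rewrite /= map_conjZ.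
rewrite eigenprojD cS !eigenproj_bigsum.
rewrite [X in _ + X]big_seq [X in _ + X]big1 => [|j /onJc h]; last first.
  by rewrite eigenprojZ h scaler0.
rewrite addr0 (bigD1_seq k) //= big_seq_cond big1 => [|j /andP[/onJ h jk]]; last first.
  by rewrite eigenprojZ h (negbTE jk) scale0r scaler0.
rewrite addr0 eigenprojZ onJ // eqxx scalerA => /eqP.
rewrite scaler_eq0 mulf_eq0 (negbTE fk) (negbTE wk0) orbF pnatr_eq0 /=.
by move=> /eqP n0; move: n_gt1; rewrite n0.
Qed.

End RealEigen.

(** * Normalisation *)

Section Enorm.
Variables (R : realType) (d : nat).
Implicit Types (v : 'rV[R]_d) (a : R).

Lemma enormE v : enorm v = Num.sqrt ((v *m v^T) ord0 ord0).
Proof. by congr Num.sqrt; rewrite mxE; apply: eq_bigr => i _; rewrite mxE expr2. Qed.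

Lemma enorm_orth v (A : 'M[R]_d) : A *m A^T = 1%:M -> enorm (v *m A) = enorm v.
Proof.
by move=> A1; rewrite !enormE trmx_mul mulmxA -(mulmxA v) A1 mulmx1.
Qed.

Lemma enorm_eq0 v : enorm v = 0 -> v = 0.
Proof.
move=> /eqP; rewrite sqrtr_eq0 => v_le0; apply/rowP => i; rewrite mxE.
have h : \sum_(i < d) v ord0 i ^+ 2 == 0.
  by rewrite eq_le v_le0 sumr_ge0 // => j _; exact: sqr_ge0.
move: h; rewrite psumr_eq0 => [/allP h|j _]; last exact: sqr_ge0.
by apply/eqP; rewrite -sqrf_eq0; apply: h; rewrite mem_index_enum.
Qed.

Lemma enormZ a v : 0 <= a -> enorm (a *: v) = a * enorm v.
Proof.
move=> a0; rewrite !enormE linearZ /= -scalemxAl -scalemxAr scalerA mxE.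
by rewrite -expr2 sqrtrM ?sqr_ge0 // sqrtr_sqr ger0_norm.
Qed.

Lemma enorm0 : enorm (0 : 'rV[R]_d) = 0.
Proof. by rewrite -(scale0r 0) enormZ // mul0r. Qed.

End Enorm.

Section Normalize.
Variables (R : realType) (T : topologicalType) (d : nat).
Variable F : T -> 'rV[R]_d.
Hypothesis F_cont : forall k, continuous (fun p => F p ord0 k).

Lemma rcont_sum (I : Type) (r : seq I) (f : I -> T -> R) :
  (forall i, continuous (f i)) -> continuous (fun p => \sum_(i <- r) f i p).
Proof.
move=> hf; elim: r => [|i r IH].
  by under eq_fun do rewrite big_nil; exact: rcont_cst.
by under eq_fun do rewrite big_cons; exact: rcontD.
Qed.


Lemma mx_continuous_at (m k : nat) (f : T -> 'M[R]_(m, k)) p :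
  (forall i j, {for p, continuous (fun q => f q i j)}) -> {for p, continuous f}.
Proof.
move=> hf A [P hP sPA].
have : \forall q \near p, forall i j, P i j (f q i j).
  apply: filter_forall => i; apply: filter_forall => j.
  exact: hf (hP i j).
by apply: filterS => q hq; apply: sPA.
Qed.

Lemma normalize_cont p : F p != 0 ->
  {for p, continuous (fun q => (enorm (F q))^-1 *: F q)}.
Proof.
move=> Fp; apply: mx_continuous_at => i j.
have -> : (fun q => ((enorm (F q))^-1 *: F q) i j) = (fun q => (enorm (F q))^-1 * F q ord0 j).
  by apply/funext => q; rewrite mxE (ord1 i).
apply: continuousM; last exact: F_cont.
apply: continuousV; first by apply: contraNneq Fp => /enorm_eq0 ->.
rewrite /enorm; apply: continuous_comp; last exact: sqrt_continuous.
by apply: rcont_sum => k; under eq_fun do rewrite expr2; exact: rcontM.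
Qed.

End Normalize.

Lemma dihedral_repr_orth (R : realType) (gT : finGroupType) (n m : nat)
    (G : {group gT}) (x y : gT) (rU : mx_representation R G m) :
  (1 < n)%N -> dihedral_presentation n G x y ->
  rU x *m (rU x)^T = 1%:M -> rU y *m (rU y)^T = 1%:M -> orthogonal_repr rU.
Proof.
move=> n_gt1 dih ox oy g /(dihedral_elts n_gt1 dih)[i [b ->]].
have [_ _ _ _ [xG yG]] := dihedral_decomp n_gt1 dih.
have orthX h k : h \in G -> rU h *m (rU h)^T = 1%:M ->
    rU (h ^+ k)%g *m (rU (h ^+ k)%g)^T = 1%:M.
  move=> hG oh; elim: k => [|k IH]; first by rewrite repr_mx1 trmx1 mulmx1.
  rewrite expgS repr_mxM ?groupX // trmx_mul mulmxA -(mulmxA (rU h)) IH mulmx1 //.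
rewrite repr_mxM ?groupX // trmx_mul mulmxA -(mulmxA (rU (x ^+ i)%g)) orthX //.
by rewrite mulmx1 orthX.
Qed.

Lemma equivariant_of_generators (R : realType) (gT : finGroupType) (n m d : nat)
    (G : {group gT}) (x y : gT) (rU : mx_representation R G m)
    (rV : mx_representation R G d) (F : 'rV[R]_m -> 'rV[R]_d) :
  (1 < n)%N -> dihedral_presentation n G x y ->
  (forall p, F (p *m rU x) = F p *m rV x) ->
  (forall p, F (p *m rU y) = F p *m rV y) ->
  forall g p, g \in G -> F (p *m rU g) = F p *m rV g.
Proof.
move=> n_gt1 dih Fx Fy g p /(dihedral_elts n_gt1 dih)[i [b ->]].
have [_ _ _ _ [xG yG]] := dihedral_decomp n_gt1 dih.
have FX h k q : h \in G -> (forall p, F (p *m rU h) = F p *m rV h) ->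
    F (q *m rU (h ^+ k)%g) = F q *m rV (h ^+ k)%g.
  move=> hG Fh; elim: k => [|k IH]; first by rewrite !repr_mx1 !mulmx1.
  by rewrite expgSr !repr_mxM ?groupX // !mulmxA Fh IH.
by rewrite !repr_mxM ?groupX // !mulmxA !FX.
Qed.

Lemma map_Re_mulmx (R : realType) (d : nat) (w : 'rV[R[i]]_d) (A : 'M[R]_d) :
  map_mx (@complex.Re R) (w *m map_mx (real_complex R) A) =
  map_mx (@complex.Re R) w *m A.
Proof.
apply/matrixP => i j; rewrite !mxE raddf_sum; apply: eq_bigr => k _ /=.
by rewrite !mxE Re_mulc /= mulr0 subr0.
Qed.

Local Close Scope complex_scope.
Import GroupScope.
Local Open Scope ring_scope.

Theorem theorem4p6 (R : realType) (gT : finGroupType) (n : nat)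
    (G : {group gT}) (x y : gT)
    (sigma : mx_representation R G 1)
    (d : nat) (rV : mx_representation R G d)
    (n_ge3 : (3 <= n)%N) (n_odd : odd n)
    (G_dihedral : dihedral_presentation n G x y)
    (sigma_x : sigma x = 1%:M) (sigma_y : sigma y = (-1)%:M)
    (rV_orth : orthogonal_repr rV)
    (rV_fpf : fixed_point_free rV)
    (rV_sigma : ~ has_summand rV sigma)
    (rV_fix : forall (p k : nat) (C : {group gT}),
        prime p -> (1 <= k)%N -> (p ^ k %| n)%N ->
        C \subset <[x]>%g -> #|C| = (p ^ k)%N ->
        rfix_mx rV C != 0) :
  anti_Borsuk_Ulam rV.
Proof.
have n_gt1 : (1 < n)%N by exact: ltnW.
have n_gt0 : (0 < n)%N by exact: ltnW.
have [om om_prim om_unit] := exists_unit_prim_root R n_gt0.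
have nofix := fixed_by_rotation_eq0 n_gt1 G_dihedral sigma_x sigma_y rV_fpf rV_sigma.
have weight_choice j : exists v, (exists u, weight_vector x y om rV j u) ->
    weight_vector x y om rV j v.
  have [[v vP]|none] := pselect (exists v, weight_vector x y om rV j v).
    by exists v.
  by exists 0 => h; case: none.
have [w wP] := boolp.choice weight_choice.
(* one exponent for each isomorphism class of planes contained in V *)
pose J := [seq j <- iota 0 n | odd j && `[< exists v, weight_vector x y om rV j v >]].
have J_uniq : uniq J by rewrite filter_uniq ?iota_uniq.
have JP j : j \in J -> [/\ odd j, (j < n)%N & weight_vector x y om rV j (w j)].
  rewrite mem_filter mem_iota add0n => /andP[/andP[jo /asboolP jw] /andP[_ jn]].
  by split=> //; exact: wP.
have J_odd : all odd J by apply/allP => j /JP[].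
have J_pfactor p : p \in \pi(n) -> exists2 j, j \in J & (p ^ logn p n %| j)%N.
  rewrite mem_primes => /and3P[p_pr _ p_n].
  have [|j [jo jn pj jw]] := exists_weight n_gt1 n_odd om_prim om_unit G_dihedral
    (rV := rV) (p := p) nofix.
    move=> C Cx oC; apply: (rV_fix p (logn p n) C) => //; last exact: pfactor_dvdnn.
    by rewrite logn_gt0 mem_primes p_pr n_gt0.
  exists j => //; rewrite mem_filter mem_iota add0n jo jn !andbT /=.
  exact/asboolP.
pose L := (\big[lcmn/1]_(j <- J) j)%N.
have nL : (n %| L)%N.
  apply/dvdn_partP => // p /J_pfactor[j jJ]; rewrite p_part => pj.
  apply: dvdn_trans pj _; rewrite /L (bigD1_seq j) //=; exact: dvdn_lcml.
have J_neq0 : J != [::].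
  have [j jJ _] : exists2 j, j \in J & (pdiv n ^ logn (pdiv n) n %| j)%N.
    by apply: J_pfactor; rewrite mem_primes pdiv_prime // n_gt0 pdiv_dvd.
  by apply: contraTneq jJ => ->.
move=> r.
pose X := plane_rot r.+1 om; pose Y := plane_flip R r.+1.
pose rU := dihedral_repr n_gt1 G_dihedral (plane_rotX r.+1 om_prim)
  (plane_flip2 R r.+1) (plane_flip_rot r.+1 n_gt1 om_prim om_unit).
have rUx : rU x = X by exact: dihedral_repr_x.
have rUy : rU y = Y by exact: dihedral_repr_y.
exists (r.+1 + r.+1)%N, rU; split.
- apply: (dihedral_repr_orth n_gt1 G_dihedral).
    by rewrite rUx plane_rot_orth.
  by rewrite rUy plane_flip_orth.
- by rewrite ltn_addr.
pose tx (p : 'rV[R]_(r.+1 + r.+1)) := p *m X; pose ty (p : 'rV[R]_(r.+1 + r.+1)) := p *m Y.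
have one_weight : weight_fun om tx ty L (fun=> 1).
  split=> [|p|p]; first exact: ccont_cst.
    by rewrite mulr1 -[L](divnK nL) mulnC exprM (prim_expr_order om_prim) expr1n.
  by rewrite rmorph1.
have coord_weight (i : 'I_r.+1) : weight_fun om tx ty 1 (plane_coord i).
  split=> [|p|p]; first exact: plane_coord_cont.
    exact: plane_coord_rot.
  exact: plane_coord_flip.
have [Phi PhiP Phi_neq0] :=
  split_weights n_odd om_prim om_unit J_neq0 J_uniq J_odd one_weight coord_weight.
pose S p := \sum_(j <- J) Phi j p *: w j.
pose F p := map_mx (@complex.Re R) (S p).
have F_neq0 p : p != 0 -> F p != 0.
  move=> p0; apply: (Re_weights_neq0 n_gt1 n_odd om_prim om_unit J_uniq JP).
  by apply: Phi_neq0; [exact: oner_neq0 | exact: plane_coord_neq0].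
have Fx p : F (p *m rU x) = F p *m rV x.
  rewrite rUx -map_Re_mulmx; congr map_mx; rewrite /S mulmx_suml !big_seq.
  apply: eq_bigr => j jJ; have [_ PhiX _] := PhiP j jJ; have [_ _ [_ wX _]] := JP j jJ.
  by rewrite -[p *m X]/(tx p) PhiX -scalemxAl wX scalerA mulrC.
have Fy p : F (p *m rU y) = F p *m rV y.
  rewrite rUy -map_Re_mulmx; apply/rowP => k; rewrite /S mulmx_suml.
  rewrite !mxE !summxE !raddf_sum !big_seq.
  apply: eq_bigr => j jJ; have [_ _ PhiY] := PhiP j jJ; have [_ _ [_ _ wY]] := JP j jJ.
  rewrite -[p *m Y]/(ty p) PhiY -scalemxAl wY !mxE /=.
  by rewrite !Re_mulc Re_conjc !Im_conjc mulNr mulrN Re_conjc.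
have Fg := equivariant_of_generators n_gt1 G_dihedral Fx Fy.
have sphere_neq0 p : unit_sphere R _ p -> p != 0.
  move=> p1; apply/eqP => p0; move: p1; rewrite /unit_sphere /= p0 enorm0.
  by move=> /esym/eqP; rewrite oner_eq0.
exists (fun p => (enorm (F p))^-1 *: F p); split.
- apply: continuous_in_subspaceT => p /set_mem /sphere_neq0 /F_neq0.
  apply: normalize_cont => k.
  (* the continuity of Phi j is available for j in J *)
  have -> : (fun p => F p ord0 k) =
    (fun p => complex.Re (\sum_(j <- J) (if j \in J then Phi j p else 0) * w j ord0 k)).
    apply/funext => q; rewrite /F /S !mxE summxE; congr complex.Re.
    by rewrite !big_seq; apply: eq_bigr => j jJ; rewrite mxE jJ.
  suff [] : ccont (fun q => \sum_(j <- J) (if j \in J then Phi j q else 0) * w j ord0 k) by [].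
  apply: ccont_sum => j; apply: ccontM; last exact: ccont_cst.
  by case: (boolP (j \in J)) => [/PhiP[]//|_]; exact: ccont_cst.
- move=> p /sphere_neq0 /F_neq0 Fp; rewrite /unit_sphere /= enormZ ?invr_ge0 ?sqrtr_ge0 //.
  by rewrite mulVf //; apply: contraNneq Fp => /enorm_eq0 ->.
- move=> g p gG _; rewrite Fg // enorm_orth; last exact: rV_orth.
  by rewrite scalemxAl.
Qed.
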